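(* Consider the weighted recursive graph with out-degree $m\in\mathbb{N}$ and assume that the vertex-weights are almost surely bounded, normalised such that $x_0:=\sup\{x\in\mathbb{R}:\mathbb{P}(W\le x)<1\}=1$. Let $\theta_m:=1+\mathbb{E}[W]/m$. Then, as $n\to\infty$, $$\frac{\max_{i\in[n]}\mathcal{Z}_n(i)}{\log n}\longrightarrow\frac{1}{\log\theta_m}\qquad\text{almost surely}.$$
   Context: Weighted recursive graph (WRG): Let $m\in\mathbb{N}=\{1,2,\dots\}$ and let $W_1,W_2,\dots$ (the vertex-weights) be i.i.d. copies of a non-negative random variable $W$ with $\mathbb{P}(W>0)=1$; set $S_n=\sum_{i=1}^nW_i$. $\mathcal{G}_1$ consists of a single vertex $1$ with weight $W_1$. For $n\ge1$, $\mathcal{G}_{n+1}$ is obtained from $\mathcal{G}_n$ by introducing a new vertex $n+1$ with weight $W_{n+1}$ and $m$ half-edges; conditionally on $\mathcal{G}_n$ (including its vertex-weights), each half-edge is connected independently to some $i\in[n]=\{1,\dots,n\}$ with probability $W_i/S_n$. Edges are directed from new to old vertices. $\mathcal{Z}_n(i)$ denotes the in-degree of vertex $i$ in $\mathcal{G}_n$. *)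

(* Defs.v *)
From HB Require Import structures.
From mathcomp Require Import all_boot all_order all_algebra finmap.
From mathcomp Require Import all_classical all_reals all_analysis.

Set Implicit Arguments.
Unset Strict Implicit.
Unset Printing Implicit Defensive.

Import Order.TTheory GRing.Theory Num.Theory.
Import numFieldNormedType.Exports.

Local Open Scope classical_set_scope.
Local Open Scope ring_scope.

Section probability_notions.
Context {d : measure_display} {Omega : measurableType d} {R : realType}.
Variable P : probability Omega R.

Definition same_law (X Y : {RV P >-> R}) : Prop :=
  forall B : set R, measurable B -> P (X @^-1` B) = P (Y @^-1` B).

Definition mutually_independent (X : nat -> {RV P >-> R}) : Prop :=
  forall (J : {fset nat}) (B : nat -> set R), (forall i, measurable (B i)) ->
    P (\bigcap_(i in [set` J]) (X i @^-1` B i)) =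
    (\prod_(i <- J) P (X i @^-1` B i))%E.

Definition independent_of (X : {RV P >-> R}) (F : set (set Omega)) : Prop :=
  forall (B : set R) (A : set Omega), measurable B -> F A ->
    P (X @^-1` B `&` A) = (P (X @^-1` B) * P A)%E.

(* [f] is a version of the conditional probability of the event [B] given the
   sub-sigma-algebra [F]. *)
Definition is_cond_prob (F : set (set Omega)) (B : set Omega) (f : Omega -> R)
    : Prop :=
  [/\ forall Y : set R, measurable Y -> F (f @^-1` Y),
      P.-integrable setT (EFin \o f) &
      forall A, F A -> P (A `&` B) = (\int[P]_(w in A) (f w)%:E)%E].

(* sup {x : P(X <= x) < 1}, as an extended real *)
Definition upper_endpoint (X : {RV P >-> R}) : \bar R :=
  ereal_sup [set x%:E | x in [set x : R | (cdf X x < 1)%E]].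

End probability_notions.

(* Vertices are numbered from 0: vertex i stands for vertex i+1 of the usual
   numbering.  Thus G_n has vertex set {0, .., n-1}, and for n >= 1 vertex n is
   the one whose addition turns G_n into G_{n+1}.  [W i] is the weight of vertex
   i and, for n >= 1, [E n k] is the vertex to which the k-th half-edge of
   vertex n is connected.  Vertex 0 has no half-edges: [E 0 k] is a dummy
   value, which is never used. *)
Section wrg.
Context {d : measure_display} {Omega : measurableType d} {R : realType}.
Variables (P : probability Omega R) (m : nat).
Variables (W : nat -> {RV P >-> R}) (E : nat -> 'I_m -> {RV P >-> nat}).

Definition total_weight (n : nat) (w : Omega) : R := \sum_(i < n) W i w.

(* sigma-algebra generated by the weights of the vertices i < a and by the
   half-edges of the vertices j < b; [wrg_sigma n n] is the one generated by
   G_n, and [wrg_sigma n n.+1] the one generated by G_n together with the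
   half-edges of the new vertex n. *)
Definition wrg_sigma (a b : nat) : set (set Omega) :=
  <<s (\bigcup_(i in [set i | (i < a)%N]) g_sigma_algebra_preimage (W i))
      `|` (\bigcup_(j in [set j | (0 < j < b)%N])
             \bigcup_(k in [set: 'I_m]) g_sigma_algebra_preimage (E j k)) >>.

(* Weighted recursive graph with out-degree [m] and vertex-weights distributed
   as [V].  Given G_n, the half-edges of vertex n are independent, each with law
   i |-> W_i / S_n on {0, .., n-1}: their joint conditional law is the product
   one.  The weight of the new vertex is fresh, i.e. it does not depend on G_n
   nor on the way the half-edges are connected. *)
Record is_WRG (V : {RV P >-> R}) : Prop := {
  wrg_same_law : forall i, same_law (W i) V;
  wrg_indep : mutually_independent W;
  wrg_range : forall n k w, (0 < n)%N -> (E n k w < n)%N;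
  wrg_edges : forall n (t : 'I_m -> 'I_n), (0 < n)%N ->
    is_cond_prob P (wrg_sigma n n)
      [set w | forall k, E n k w = t k :> nat]
      (fun w => \prod_(k < m) (W (t k) w / total_weight n w));
  wrg_fresh : forall n, (0 < n)%N -> independent_of (W n) (wrg_sigma n n.+1)
}.

Definition indegree (n i : nat) (w : Omega) : nat :=
  (\sum_(1 <= j < n) \sum_(k < m) (E j k w == i))%N.

Definition max_indegree (n : nat) (w : Omega) : nat :=
  (\max_(i < n) indegree n i w)%N.

End wrg.

Definition theta {d : measure_display} {Omega : measurableType d}
    {R : realType} (P : probability Omega R) (m : nat) (V : {RV P >-> R}) : R :=
  1 + fine ('E_P[V])%E / m%:R.

(* Main.v *)
Require Import Defs.
From HB Require Import structures.
From mathcomp Require Import all_boot all_order all_algebra finmap.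
From mathcomp Require Import all_classical all_reals all_analysis.
From mathcomp Require Import measurable_realfun.
From mathcomp Require Import ring lra zify.
Set Implicit Arguments.
Unset Strict Implicit.
Unset Printing Implicit Defensive.
Import Order.TTheory GRing.Theory Num.Theory.
Import numFieldNormedType.Exports.
Local Open Scope classical_set_scope.
Local Open Scope ring_scope.

(** Why the theorem is true.  Write mu for the mean weight, S_j for the total
    weight of the first j vertices, Z_n(i) for the in-degree of i at time n and
    theta = 1 + mu / m.  By the law of large numbers S_j is close to mu j, so a
    vertex of weight close to 1, the largest possible value, receives in the
    step from j to j + 1 about m independent chances 1 / (mu j).  Hence between
    times n0 and n its in-degree grows by a nearly Poisson variable of mean
    (m / mu) log (n / n0).

    Upper bound.  On the event that S_j >= b j, with b slightly below mu, the
    conditional expectation of theta ^ Z_(j+1)(i) is at most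
    theta ^ Z_j(i) times exp (m (theta - 1) / (b j)), where
    m (theta - 1) / b = mu / b is close to 1.  Summed over the vertices, this
    bounds the expectation of sum_i theta ^ Z_n(i) by n ^ (mu / b), up to a
    logarithm, so that Markov's inequality excludes an in-degree larger than
    c log n as soon as c log theta > mu / b (integral_sum_pow_le,
    measure_max_indegree_ge_le, ae_max_indegree_lt).

    Lower bound.  Fix c with c log theta < 1 and look only at vertices of weight
    at least a < 1 born before time n0 = n ^ gam; the law of large numbers gives
    at least rho n0 of them.  Let g be the probability that a sum of independent
    indicators, whose success probabilities are lower bounds of the true
    connection probabilities between n0 and n, reaches k = c log n.  A half-edge
    hits a single vertex, which makes the in-degrees negatively dependent: the
    product over the heavy vertices of the probabilities of staying below k,
    each computed from the current in-degree, is a supermartingale (edges_le,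
    all_miss_step).  All of them therefore stay below k with probability at most
    (1 - g) ^ (rho n0) <= exp (- rho n0 g) (measure_max_indegree_lt_le).
    A Poisson-type lower bound for g shows that, for
    gam = 1 - c / (m / mu + 1), the product n0 g is of order
    n ^ (1 - c log theta), up to corrections in the exponent that vanish as a
    and the bound on S_j / j are taken closer to 1 and mu
    (success_tail_odds_ge).

    Both failure probabilities are geometric along the times n = exp (k / c), so
    Borel-Cantelli applies; the maximal in-degree is monotone in n and log n
    varies by a bounded amount between consecutive such times, which gives the
    limit along all n (cvg_ratio_ln).

    Conditioning is done without conditional expectations: the in-degrees
    depend on countably many values of the past edges, so every inequality for
    one step of the graph can be checked on the atoms of the past
    (wrg_step_le). *)

(** * Harmonic sums and a geometric grid of times *)

Section harmonic.
Context {R : realType}.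
Implicit Types (x y c : R) (a b : nat).

Definition harm (a b : nat) : R := \sum_(a <= j < b) j%:R^-1.

Lemma harm_ge0 a b : 0 <= harm a b.
Proof. by apply: sumr_ge0 => i _; rewrite invr_ge0. Qed.

Lemma harmS a b : (a <= b)%N -> harm a b.+1 = harm a b + b%:R^-1.
Proof. by move=> ab; rewrite /harm big_nat_recr. Qed.

Lemma ln_sub_le x y : 0 < x -> 0 < y -> ln y - ln x <= (y - x) / x.
Proof.
move=> x0 y0; rewrite -ln_div ?posrE//.
have -> : y / x = 1 + (y - x) / x by field; lra.
apply: le_ln1Dx.
have -> : (y - x) / x = y / x - 1 by field; lra.
have : 0 < y / x by rewrite divr_gt0.
lra.
Qed.

Lemma harm_ge_ln a b : (0 < a <= b)%N -> ln b%:R - ln a%:R <= harm a b.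
Proof.
move=> /andP[a0]; elim: b => [|b IH ab]; first by move=> ?; exfalso; lia.
have [ab'|] := leqP a b; last first.
  move=> ba; have -> : b.+1 = a by lia.
  by rewrite subrr harm_ge0.
rewrite harmS//; move: (IH ab').
have b0 : 0 < (b%:R : R) by rewrite ltr0n; lia.
have := @ln_sub_le b%:R b.+1%:R b0 _; rewrite ltr0n => /(_ isT).
have -> : (b.+1%:R - b%:R) / b%:R = b%:R^-1 :> R by rewrite -natr1; field; lra.
lra.
Qed.

Lemma harm_le_ln a b : (0 < a <= b)%N -> harm a b <= 1 + ln b%:R - ln a%:R.
Proof.
move=> /andP[a0 ab].
have H i : (a <= i)%N -> harm a i.+1 <= a%:R^-1 + ln i%:R - ln a%:R.
  elim: i => [|i IH ai]; first by move=> ?; exfalso; lia.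
  have [ai'|] := leqP a i; last first.
    move=> ia; have <- : a = i.+1 by lia.
    by rewrite harmS// /harm big_geq// add0r addrK.
  rewrite harmS//; have := IH ai'.
  have i0 : 0 < (i%:R : R) by rewrite ltr0n; lia.
  have := @ln_sub_le i.+1%:R i%:R _ i0; rewrite ltr0n => /(_ isT).
  have -> : (i%:R - i.+1%:R) / i.+1%:R = - i.+1%:R^-1 :> R.
    by rewrite -natr1; field; lra.
  move: (ln i.+1%:R) (i.+1%:R^-1) => x2 x5 h1 h2; lra.
have a1 : a%:R^-1 <= 1 :> R by rewrite invf_le1 ?ltr0n// ler1n.
case: b ab => [|b] ab; first by lia.
have [ab'|] := leqP a b; last first.
  move=> ba; have <- : a = b.+1 by lia.
  by rewrite addrK /harm big_geq.
have b0 : (0 < b)%N by lia.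
have : ln b%:R <= ln b.+1%:R :> R by rewrite ler_ln ?posrE ?ltr0n// ler_nat; lia.
have := H _ ab'; lra.
Qed.

(** The counting step of the upper bound needs the number of vertices to be
    dominated by the exponential of the harmonic sum, without any constant. *)
Lemma expR_harm_ge n : n.+1%:R <= expR (harm 1 n.+1).
Proof.
have := @harm_ge_ln 1 n.+1 isT; rewrite ln1 subr0 => h.
by rewrite -[leLHS]lnK ?posrE ?ltr0n// ler_expR.
Qed.

(** The times at which Borel-Cantelli is applied: at time grid c k the threshold
    c log n is k, up to rounding.  Rounding down is the choice for which
    n <= exp (k / c) is equivalent to n <= grid c k. *)
Definition grid (c : R) (k : nat) : nat := Num.truncn (expR (k%:R / c)).

Lemma grid_le c k : (grid c k)%:R <= expR (k%:R / c).
Proof. by rewrite truncn_le expR_ge0. Qed.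

Lemma grid_gt c k : expR (k%:R / c) < (grid c k).+1%:R.
Proof. exact: truncnS_gt. Qed.

Lemma grid_gt0 c k : 0 < c -> (0 < grid c k)%N.
Proof. by move=> c0; rewrite truncn_gt0 -expR0 ler_expR divr_ge0// ltW. Qed.

Lemma expR_grid_le2 c k : 0 < c -> expR (k%:R / c) <= 2 * (grid c k)%:R.
Proof.
move=> /(@grid_gt0 _ k); rewrite -(ler_nat R) => g0.
by apply: (le_trans (ltW (grid_gt c k))); rewrite -natr1; lra.
Qed.

Lemma expR1_ge2 : 2 <= expR 1 :> R.
Proof. by have := expR_ge1Dx (1 : R); lra. Qed.

Lemma ln_grid_le c k : 0 < c -> ln (grid c k)%:R <= k%:R / c.
Proof.
move=> c0; have g0 := grid_gt0 k c0.
by rewrite -[leRHS]expRK ler_ln ?posrE ?expR_gt0 ?ltr0n// grid_le.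
Qed.

Lemma ln_grid_ge c k : 0 < c -> k%:R / c - 1 <= ln (grid c k)%:R.
Proof.
move=> c0; have := grid_gt0 k c0; rewrite -(ltr0n R) => g0.
rewrite -[leLHS]expRK ler_ln ?posrE ?expR_gt0//.
rewrite expRD expRN ler_pdivrMr ?expR_gt0//.
have := expR_grid_le2 k c0; have := expR1_ge2; nra.
Qed.

Lemma grid_ge (c : R) (N : nat) : 0 < c -> exists K, forall k, (K <= k)%N -> (N <= grid c k)%N.
Proof.
move=> c0; exists (Num.truncn (c * N%:R)).+1 => k Kk.
have : c * N%:R <= k%:R.
  by rewrite ltW// (lt_le_trans (truncnS_gt _))// ler_nat.
rewrite mulrC -ler_pdivlMr// => h.
rewrite /grid truncn_ge_nat ?expR_ge0//.
by apply: (le_trans h); have := expR_ge1Dx (k%:R / c); lra.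
Qed.

Lemma harm_grid_le (c : R) k : 0 < c -> harm 1 (grid c k) <= 1 + k%:R / c.
Proof.
move=> c0; have g0 := grid_gt0 k c0.
have := @harm_le_ln 1 (grid c k); rewrite g0 => /(_ isT).
by rewrite ln1 subr0 => h; apply: (le_trans h); rewrite lerD2l ln_grid_le.
Qed.

End harmonic.

(** * Large deviations of a sum of independent indicators *)

Section success_probability.
Context {R : realType}.
Implicit Types (x y q c : R) (s : seq R).

(** The upper half of Stirling's formula, k! <= e k (k / e) ^ k; the induction
    step is (1 + 1 / k) ^ (k + 1) >= e. *)
Lemma fact_expR_le k : (0 < k)%N ->
  k`!%:R * expR 1 ^+ k <= expR 1 * k%:R ^+ k.+1 :> R.
Proof.
have e0 : 0 < expR 1 :> R by exact: expR_gt0.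
case: k => // k _; elim: k => [|k IH].
  by rewrite (_ : 1`! = 1%N)// !expr1n mul1r mulr1.
rewrite factS natrM.
set u : R := k.+1%:R in IH *; set v : R := k.+2%:R.
have u0 : 0 < u by rewrite ltr0n.
have v0 : 0 < v by rewrite ltr0n.
have uv : v = u + 1 by rewrite /v /u -natr1.
have key : expR 1 * u ^+ k.+2 <= v ^+ k.+2.
  have -> : expR 1 = expR (v^-1) ^+ k.+2 :> R.
    by rewrite -expRM_natr mulVf// gt_eqF.
  rewrite -exprMn; apply: lerXn2r.
  - by rewrite nnegrE mulr_ge0 ?expR_ge0// ltW.
  - by rewrite nnegrE ltW.
  - rewrite mulrC -ler_pdivlMr ?expR_gt0// -expRN.
    have := expR_ge1Dx (- v^-1).
    move=> /(ler_wpM2l (ltW v0)) h.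
    have -> : u = v * (1 + - v^-1) by rewrite uv; field; lra.
    exact: h.
have := ler_wpM2l (ltW (mulr_gt0 v0 e0)) IH.
rewrite [expR 1 ^+ k.+2]exprS [v ^+ k.+3]exprS => h.
have -> : v * k.+1`!%:R * (expR 1 * expR 1 ^+ k.+1) =
          v * expR 1 * (k.+1`!%:R * expR 1 ^+ k.+1) by ring.
apply: (le_trans h).
have -> : v * expR 1 * (expR 1 * u ^+ k.+2) = (expR 1 * v) * (expR 1 * u ^+ k.+2) by ring.
rewrite [leRHS]mulrA; apply: ler_wpM2l => //.
by rewrite ltW// mulr_gt0.
Qed.

(** Probability of at least r successes in independent trials, where a trial
    with odds a succeeds with probability a / (1 + a).  In terms of odds the
    probability of exactly r successes is the r-th elementary symmetric
    polynomial divided by the product of the 1 + a, which is what makes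
    success_tail_ge an easy induction. *)
Fixpoint success_tail (s : seq R) (r : nat) : R :=
  if s is a :: s' then (success_tail s' r + a * success_tail s' r.-1) / (1 + a) else (r == 0)%:R.

Lemma success_tail_itv s r : all (>= 0) s -> 0 <= success_tail s r <= 1.
Proof.
elim: s r => [|a s IH] r /=; first by case: (r == 0%N); rewrite lexx ler01.
move=> /andP[a0 s0]; have /andP[h0 h1] := IH r s0; have /andP[g0 g1] := IH r.-1 s0.
rewrite ler_pdivlMr ?ler_pdivrMr ?mul0r ?mul1r; [|lra..].
by rewrite addr_ge0 ?mulr_ge0//=; nra.
Qed.

Lemma success_tail_noninc s r : all (>= 0) s -> success_tail s r.+1 <= success_tail s r.
Proof.
elim: s r => [|a s IH] r /=; first by case: r => //=; rewrite ler01.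
move=> /andP[a0 s0].
rewrite ler_pM2r ?invr_gt0; last by lra.
apply: lerD; first exact: IH.
case: r => [|r] /=; first by [].
by apply: ler_wpM2l => //; apply: IH.
Qed.

(** Convexity of the power of the positive part: the increment over a step of
    length q is at most q times the derivative at the right end. *)
Lemma expr_shift_le (y q : R) r : 0 <= q ->
  Num.max 0 (y + q) ^+ r.+1 <=
  Num.max 0 y ^+ r.+1 + q * r.+1%:R * Num.max 0 (y + q) ^+ r.
Proof.
move=> q0; set v := Num.max 0 (y + q); set u := Num.max 0 y.
have u0 : 0 <= u by rewrite le_max lexx.
have v0 : 0 <= v by rewrite le_max lexx.
have uv : v - u <= q.
  rewrite /v /u; case: (leP 0 (y + q)); case: (leP 0 y); lra.
have uv' : u <= v.
  rewrite /v /u; case: (leP 0 (y + q)); case: (leP 0 y); lra.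
elim: r => [|r IH]; first by rewrite !expr1 expr0; lra.
rewrite exprS [u ^+ r.+2]exprS [r.+2%:R]mulrSr.
have p0 : 0 <= v ^+ r.+1 by exact: exprn_ge0.
have pu0 : 0 <= u ^+ r.+1 by exact: exprn_ge0.
have : v * v ^+ r.+1 <= u * v ^+ r.+1 + q * v ^+ r.+1 by nra.
have : u * v ^+ r.+1 <= u * u ^+ r.+1 + u * (q * r.+1%:R * v ^+ r).
  by rewrite -mulrDr; apply: ler_wpM2l.
have : u * (q * r.+1%:R * v ^+ r) <= q * r.+1%:R * v ^+ r.+1.
  rewrite [v ^+ r.+1]exprS mulrCA; apply: ler_wpM2l.
    by rewrite mulr_ge0.
  by apply: ler_wpM2r => //; apply: exprn_ge0.
lra.
Qed.

(** A Poisson-type lower bound.  The r-th elementary symmetric polynomial of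
    numbers a_i <= c is at least (sum a - r c)_+ ^ r / r!, because choosing r
    distinct indices one after the other loses at most c at each choice, and
    the product of the 1 / (1 + a) is at least exp (- sum a). *)
Lemma success_tail_ge s r c : all (fun a : R => 0 <= a <= c) s -> 0 <= c ->
  expR (- \sum_(a <- s) a) * Num.max 0 (\sum_(a <- s) a - r%:R * c) ^+ r / r`!%:R
  <= success_tail s r.
Proof.
move=> + c0; elim: s r => [|a s IH] r /=.
  move=> _; rewrite !big_nil oppr0 expR0 mul1r sub0r.
  case: r => [|r] /=; first by rewrite expr0 fact0 invr1 mulr1.
  rewrite max_l ?expr0n ?mul0r//.
  by rewrite oppr_le0 mulr_ge0.
move=> /andP[/andP[a0 ac] sc]; rewrite !big_cons.
set x := \sum_(j <- s) j.
have a1 : 0 < 1 + a by lra.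
have fp n : 0 < (n`!%:R : R) by rewrite ltr0n fact_gt0.
rewrite ler_pdivlMr//.
have ea : expR (- (a + x)) * (1 + a) <= expR (- x).
  rewrite opprD expRD mulrAC -[leRHS]mul1r; apply: ler_wpM2r; first exact: expR_ge0.
  by rewrite mulrC expRN ler_pdivrMr ?expR_gt0// mul1r expR_ge1Dx.
case: r => [|r] /=.
  have := IH 0%N sc; rewrite !expr0 !fact0 !mulr1 !invr1 !mulr1 -/x => h.
  have ha : 0 <= a * success_tail s 0 by rewrite mulr_ge0// (le_trans _ h)// expR_ge0.
  by apply: (le_trans ea); apply: (le_trans h); rewrite lerDl.
have h1 := IH r.+1 sc; have h0 := IH r sc; rewrite -/x in h0 h1.
have sh := @expr_shift_le (x - r.+1%:R * c) a r a0.
set u := Num.max 0 (x - r.+1%:R * c) in h1 sh.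
set v := Num.max 0 (x - r.+1%:R * c + a) in sh.
set z := Num.max 0 (x - r%:R * c) in h0.
have -> : a + x - r.+1%:R * c = x - r.+1%:R * c + a by ring.
rewrite -/v.
have vz : v <= z.
  rewrite /v /z -[r.+1]addn1 natrD mulrDl mul1r ge_max le_max lexx/=.
  by rewrite le_max; apply/orP; right; lra.
have v0 : 0 <= v by rewrite le_max lexx.
have vzr : v ^+ r <= z ^+ r by apply: lerXn2r => //; rewrite nnegrE// (le_trans v0).
have E0 := expR_ge0 (- x).
apply: (@le_trans _ _ (expR (- x) * (v ^+ r.+1 / r.+1`!%:R))).
  rewrite -(mulrA (expR _) (_ ^+ _)) mulrAC; apply: ler_wpM2r => //.
  by rewrite divr_ge0 ?exprn_ge0// ltW.
apply: (@le_trans _ _ (expR (- x) * (u ^+ r.+1 / r.+1`!%:R) + a * (expR (- x) * z ^+ r / r`!%:R))); last first.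
  by apply: lerD; [rewrite mulrA | apply: ler_wpM2l].
have -> : a * (expR (- x) * z ^+ r / r`!%:R) = expR (- x) * (a * z ^+ r / r`!%:R) by ring.
rewrite -mulrDr; apply: ler_wpM2l => //.
rewrite factS natrM.
have -> : a * z ^+ r / r`!%:R = (a * r.+1%:R * z ^+ r) / (r.+1%:R * r`!%:R).
  by field; rewrite !gt_eqF//= ?fp// ltr0n.
rewrite -mulrDl; apply: ler_wpM2r.
  by rewrite invr_ge0 mulr_ge0// ltW.
apply: (le_trans sh); rewrite lerD2l; apply: ler_wpM2l => //.
by rewrite mulr_ge0.
Qed.

(** The odds of the half-edges that arrive between times i and n for hitting one
    given vertex of weight a, when the total weight at time l is at most b l and
    c = a / b: the true probability a / (b l) is replaced by the smaller value
    (c / l) / (1 + c / l), whose odds are c / l. *)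
Definition odds (m : nat) (c : R) (i n : nat) : seq R :=
  flatten [seq nseq m (c / l%:R) | l <- index_iota i n].

Lemma oddsS m c i n : (i < n)%N ->
  odds m c i n = nseq m (c / i%:R) ++ odds m c i.+1 n.
Proof.
move=> ij; rewrite /odds /index_iota.
by have -> : (n - i = (n - i.+1).+1)%N by lia.
Qed.

Lemma odds_nil m c n : odds m c n n = [::].
Proof. by rewrite /odds /index_iota subnn. Qed.

Lemma sum_odds m c i n : \sum_(x <- odds m c i n) x = m%:R * c * harm i n.
Proof.
rewrite /odds big_flatten/= big_map /harm mulr_sumr.
by apply: eq_bigr => l _; rewrite big_nseq iter_addr_0 -[(_ / _) *+ m]mulr_natl mulrA.
Qed.

Lemma odds_le m c i n : 0 <= c -> (0 < i)%N ->
  all (fun x : R => 0 <= x <= c / i%:R) (odds m c i n).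
Proof.
move=> c0 i0; apply/allP => x /flattenP[/= s /mapP[/= l]].
rewrite mem_index_iota => /andP[il ln] -> /nseqP[-> _].
rewrite divr_ge0//= ler_wpM2l// lef_pV2 ?posrE ?ltr0n ?ler_nat//; lia.
Qed.

Lemma one_sub_ge (y : R) : 0 <= y -> y <= 1 / 2 -> expR (- (2 * y)) <= 1 - y.
Proof.
move=> y0 y1; rewrite expRN -[leRHS]invrK lef_pV2 ?posrE ?expR_gt0//; last first.
  by rewrite invr_gt0; lra.
apply: le_trans (expR_ge1Dx _).
rewrite -div1r ler_pdivrMr; last by lra.
by nra.
Qed.

(** A vertex born before time n0 = exp (gam k / c) reaches degree k at time
    n = exp (k / c) with a probability that, multiplied by n0, is exponentially
    large in k.  With lam = m kap the number of successes is nearly Poisson of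
    mean A = lam (1 - gam) k / c, so the exponent is
    gam / c + log (A / k) + 1 - A / k per unit of k.  It is maximal for
    1 - gam = c / (lam + 1), where A / k = lam / (lam + 1) = 1 / (1 + 1 / lam)
    and the exponent equals 1 / c - log (1 + 1 / lam) > 0. *)
Lemma success_tail_odds_ge (m : nat) (kap c : R) : 0 < kap -> (0 < m)%N -> 0 < c ->
  c * ln (1 + (m%:R * kap)^-1) < 1 ->
  exists gam C dlt : R, [/\ 0 < gam, gam < 1, 0 < C, 0 < dlt &
  exists K : nat, forall k, (K <= k)%N ->
    C * expR (dlt * k%:R) <=
    (grid (c / gam) k)%:R * success_tail (odds m kap (grid (c / gam) k) (grid c k)) k].
Proof.
move=> kap0 m0 c0; set lam := m%:R * kap; set L := ln _ => cL.
have lam0 : 0 < lam by rewrite mulr_gt0// ltr0n.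
have lamN : lam != 0 by rewrite gt_eqF.
have lam1N : lam + 1 != 0 by rewrite gt_eqF//; lra.
have cN : c != 0 by rewrite gt_eqF.
pose t := lam / (lam + 1).
have t0 : 0 < t by rewrite divr_gt0//; lra.
have Lt : - L = ln t.
  rewrite /L /t -lnV ?posrE ?addr_gt0 ?invr_gt0//; congr ln.
  by field; rewrite lamN lam1N.
have expL : expR (- L) = t by rewrite Lt lnK.
have L1 : (lam + 1)^-1 <= L.
  have := expR_ge1Dx (- L); rewrite expL /t.
  have -> : lam / (lam + 1) = 1 - (lam + 1)^-1 by field.
  lra.
pose gam : R := 1 - c / (lam + 1).
have cl0 : 0 < c / (lam + 1) by rewrite divr_gt0//; lra.
have gam0 : 0 < gam.
  have : c / (lam + 1) <= c * L by apply: ler_wpM2l; first exact: ltW.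
  by rewrite /gam; lra.
have gam1 : gam < 1 by rewrite /gam; lra.
pose dlt := (c^-1 - L) / 2.
have dlt0 : 0 < dlt.
  by rewrite divr_gt0// subr_gt0 -[c^-1]mul1r ltr_pdivlMr// mulrC.
(* Bounds the loss in the mean: lam from the rounding of n and n0 in the
   harmonic sum, and k kap / n0 from the repeated choices. *)
pose C2 := lam + 2 * kap * c / gam.
have C20 : 0 < C2 by rewrite addr_gt0// divr_gt0// !mulr_gt0.
pose C := dlt * expR (- (2 * lam) - 2 * C2 / t - 1) / 2.
exists gam, C, dlt; split=> //.
  by rewrite /C divr_gt0// mulr_gt0// expR_gt0.
exists (Num.truncn (2 * C2 / t)).+1 => k Kk.
have kC2 : 2 * C2 / t <= k%:R.
  by rewrite ltW// (lt_le_trans (truncnS_gt _))// ler_nat.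
have k1 : (0 < k)%N by exact: leq_ltn_trans Kk.
have kR : 0 < k%:R :> R by rewrite ltr0n.
have cg0 : 0 < c / gam by rewrite divr_gt0.
set n := grid c k; set n0 := grid (c / gam) k.
have n00 : 0 < n0%:R :> R by rewrite ltr0n grid_gt0.
have kcg : k%:R / (c / gam) = gam * k%:R / c by field; rewrite !gt_eqF.
have n0n : (n0 <= n)%N.
  apply: le_truncn; rewrite ler_expR kcg ler_pM2r ?invr_gt0//.
  by rewrite -[leRHS]mul1r ler_wpM2r// ltW.
have hr : (0 < n0 <= n)%N by rewrite grid_gt0.
set x := \sum_(a <- odds m kap n0 n) a.
have kt : lam * ((1 - gam) * k%:R / c) = k%:R * t.
  by rewrite /gam /t; field; rewrite lam1N cN.
have x_le : x <= k%:R * t + 2 * lam.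
  rewrite /x sum_odds -/lam -kt [2 * _]mulrC -mulrDr ler_pM2l//.
  apply: (le_trans (harm_le_ln hr)).
  have := ln_grid_le k c0; have := ln_grid_ge k cg0.
  rewrite kcg -/n -/n0 => h1 h2.
  have -> : (1 - gam) * k%:R / c = k%:R / c - gam * k%:R / c by field; rewrite gt_eqF.
  by move: (ln n%:R) (ln n0%:R) (k%:R / c) (gam * k%:R / c) h1 h2 => ? ? ? ? ? ?; lra.
have x_ge : k%:R * t - lam <= x.
  rewrite /x sum_odds -/lam -kt -[X in _ - X]mulr1 -mulrBr ler_pM2l//.
  apply: le_trans (harm_ge_ln hr).
  have := ln_grid_ge k c0; have := ln_grid_le k cg0.
  rewrite kcg -/n -/n0 => h1 h2.
  have -> : (1 - gam) * k%:R / c = k%:R / c - gam * k%:R / c by field; rewrite gt_eqF.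
  by move: (ln n%:R) (ln n0%:R) (k%:R / c) (gam * k%:R / c) h1 h2 => ? ? ? ? ? ?; lra.
have en0 : expR (gam * k%:R / c) <= 2 * n0%:R by rewrite -kcg expR_grid_le2.
have kn0 : k%:R * (kap / n0%:R) <= 2 * kap * c / gam.
  rewrite mulrA ler_pdivrMr//.
  have : gam * k%:R / c <= 2 * n0%:R.
    by apply: le_trans en0; have := expR_ge1Dx (gam * k%:R / c); lra.
  rewrite ler_pdivrMr// => h.
  have -> : 2 * kap * c / gam * n0%:R = kap / gam * (2 * n0%:R * c) by field; rewrite gt_eqF.
  have -> : k%:R * kap = kap / gam * (gam * k%:R) by field; rewrite gt_eqF.
  by apply: ler_wpM2l => //; rewrite divr_ge0// ltW.
pose B := x - k%:R * (kap / n0%:R).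
have B_ge : k%:R * t * (1 - C2 / (k%:R * t)) <= B.
  rewrite mulrBr mulr1 [X in _ - X]mulrC divfK; last by rewrite mulf_neq0// gt_eqF.
  by rewrite /B /C2; lra.
have kt0 : 0 < k%:R * t by exact: mulr_gt0.
have y0 : 0 <= C2 / (k%:R * t).
  by apply: divr_ge0; [exact: ltW | apply: mulr_ge0; exact: ltW].
have y1 : C2 / (k%:R * t) <= 1 / 2.
  rewrite ler_pdivrMr//.
  by move: kC2; rewrite ler_pdivrMr//; lra.
have y2 : 0 <= 1 - C2 / (k%:R * t).
  by rewrite subr_ge0 (le_trans y1)//; lra.
have Bk : (k%:R * t) ^+ k * expR (- (2 * C2 / t)) <= B ^+ k.
  have -> : - (2 * C2 / t) = - (2 * (C2 / (k%:R * t))) * k%:R.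
    by field; rewrite !gt_eqF.
  rewrite expRM_natr -exprMn; apply: lerXn2r.
  - by rewrite nnegrE mulr_ge0 ?expR_ge0// ltW.
  - by rewrite nnegrE (le_trans _ B_ge)// mulr_ge0// ltW.
  - apply: le_trans B_ge; rewrite ler_pM2l//; exact: one_sub_ge.
have oall : all (fun a : R => 0 <= a <= kap / n0%:R) (odds m kap n0 n).
  by apply: odds_le; rewrite ?ltW// grid_gt0.
have kn0' : 0 <= kap / n0%:R by rewrite divr_ge0// ltW.
have := success_tail_ge k oall kn0'; rewrite -/x -/B => hitge.
have fp : 0 < k`!%:R :> R by rewrite ltr0n fact_gt0.
have hitge2 : expR (- x) * B ^+ k / k`!%:R <= success_tail (odds m kap n0 n) k.
  apply: le_trans hitge; rewrite ler_pM2r ?invr_gt0//.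
  apply: ler_wpM2l; first exact: expR_ge0.
  apply: lerXn2r; rewrite ?nnegrE ?le_max ?lexx ?orbT//.
  by rewrite (le_trans _ B_ge)// mulr_ge0// ltW.
have fle := fact_expR_le k1.
pose K0 := expR (- (2 * lam) - 2 * C2 / t - 1).
(* the exponents of the lower bounds add up to (1/c - L) k *)
have ekt : expR (- (k%:R * t + 2 * lam)) * ((k%:R * t) ^+ k * expR (- (2 * C2 / t)))
    * expR 1 ^+ k / (expR 1 * k%:R ^+ k.+1) * expR (gam * k%:R / c)
    = K0 * expR (2 * dlt * k%:R) / k%:R.
  have kk0 : k%:R ^+ k != 0 :> R by rewrite expf_neq0// gt_eqF.
  have tk : t ^+ k = expR (- L * k%:R) by rewrite expRM_natr expL.
  have -> : expR 1 ^+ k = expR (k%:R) :> R by rewrite -expRM_natr mul1r.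
  rewrite exprMn tk [k%:R ^+ k.+1]exprS.
  have e1 : expR 1 != 0 :> R by rewrite gt_eqF// expR_gt0.
  transitivity (expR (- (k%:R * t + 2 * lam)) * expR (- L * k%:R) *
    expR (- (2 * C2 / t)) * expR k%:R * (expR 1)^-1 * expR (gam * k%:R / c) / k%:R).
    by move: (expR _) (expR _) (expR _) (expR _) => *; field; rewrite e1 kk0 gt_eqF.
  rewrite -expRN -!expRD; congr (_ / _); congr expR.
  rewrite /dlt /gam /t; field.
  by rewrite lamN lam1N cN.
have B0 : 0 <= B ^+ k.
  apply: exprn_ge0; apply: le_trans B_ge.
  by rewrite mulr_ge0// ltW.
have e1k : 0 < expR 1 ^+ k :> R by rewrite exprn_gt0// expR_gt0.
have dk : dlt * k%:R <= expR (dlt * k%:R).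
  by have := expR_ge1Dx (dlt * k%:R); lra.
apply: (@le_trans _ _ (K0 * expR (2 * dlt * k%:R) / k%:R / 2)).
  rewrite /C -/K0 mulrAC ler_pM2r ?invr_gt0//.
  rewrite ler_pdivlMr//.
  have -> : 2 * dlt * k%:R = dlt * k%:R + dlt * k%:R by ring.
  rewrite expRD.
  have -> : dlt * K0 * expR (dlt * k%:R) * k%:R =
    K0 * (dlt * k%:R * expR (dlt * k%:R)) by ring.
  apply: ler_wpM2l; first exact: expR_ge0.
  by apply: ler_wpM2r => //; exact: expR_ge0.
rewrite -ekt -mulrA mulrC; apply: ler_pM.
- by rewrite divr_ge0// expR_ge0.
- apply: divr_ge0; last by rewrite mulr_ge0 ?expR_ge0 ?exprn_ge0.
  apply: mulr_ge0; last exact: ltW.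
  apply: mulr_ge0; first exact: expR_ge0.
  apply: mulr_ge0; last exact: expR_ge0.
  by apply: exprn_ge0; exact: ltW.
- by rewrite ler_pdivrMr// [leRHS]mulrC.
have e1p : 0 < expR 1 * k%:R ^+ k.+1 :> R.
  by apply: mulr_gt0; [exact: expR_gt0 | exact: exprn_gt0].
have ktk : 0 <= (k%:R * t) ^+ k by apply: exprn_ge0; exact: ltW.
apply: le_trans hitge2; rewrite -mulrA; apply: ler_pM.
- by apply: mulr_ge0; [exact: expR_ge0 | apply: mulr_ge0 => //; exact: expR_ge0].
- by apply: divr_ge0; apply: ltW.
- apply: ler_pM => //; first by apply: mulr_ge0 => //; exact: expR_ge0.
  by rewrite ler_expR lerN2.
- by rewrite ler_pdivrMr// mulrC ler_pdivlMr// mulrC.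
Qed.

End success_probability.

(** * Negative dependence of the half-edges of one vertex *)

Section edges.
Context {R : realType}.

(** The transition operator of a counter that increases with probability q. *)
Definition mix (q : R) (h : nat -> R) : nat -> R := fun z => (1 - q) * h z + q * h z.+1.

Lemma mix_noninc q h : 0 <= q -> q <= 1 -> (forall z, h z.+1 <= h z) ->
  forall z, mix q h z.+1 <= mix q h z.
Proof.
by move=> q0 q1 hd z; apply: lerD; apply: ler_wpM2l => //; lra.
Qed.

Lemma mix_ge0 q h : 0 <= q -> q <= 1 -> (forall z, 0 <= h z) -> forall z, 0 <= mix q h z.
Proof. by move=> q0 q1 h0 z; rewrite addr_ge0// mulr_ge0//; lra. Qed.

(** Negative dependence of one half-edge.  It hits at most one vertex, so the
    decreasing functions of the counters are negatively correlated: adding a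
    vertex x to J changes the left side from L to h (z x) L - p x d A, where d
    is the drop of h at z x and A >= L is the product without any hit, and this
    is at most (h (z x) - q d) L. *)
Lemma one_edge_le n (p : 'I_n -> R) q (J : seq nat) (z : nat -> nat) (h : nat -> R) :
  (forall z, 0 <= h z) -> (forall z, h z.+1 <= h z) -> 0 <= q -> q <= 1 ->
  (forall i, 0 <= p i) -> \sum_i p i = 1 -> uniq J ->
  (forall l, l \in J -> exists2 i : 'I_n, i = l :> nat & q <= p i) ->
  \sum_i p i * \prod_(l <- J) h (z l + (i == l :> nat))%N
    <= \prod_(l <- J) mix q h (z l).
Proof.
move=> h0 hd q0 q1 p0 p1; elim: J => [|x J IH] /=.
  move=> _ _; rewrite big_nil.
  by under eq_bigr do rewrite big_nil mulr1; rewrite p1.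
move=> /andP[xJ uJ] pJ; rewrite big_cons.
have {}IH : \sum_i p i * \prod_(l <- J) h (z l + (i == l :> nat))%N
    <= \prod_(l <- J) mix q h (z l).
  by apply: IH => // l lJ; apply: pJ; rewrite inE lJ orbT.
have [ix ixx qp] := pJ x (mem_head _ _).
set L := \sum_i p i * \prod_(l <- J) _ in IH.
pose A := \prod_(l <- J) h (z l).
have LA : L <= A.
  rewrite -[A]mul1r -p1 mulr_suml; apply: ler_sum => i _.
  apply: ler_wpM2l => //; apply: ler_prod => l _; rewrite h0/=.
  by case: (_ == _); rewrite ?addn0// addn1.
have L0 : 0 <= L by apply: sumr_ge0 => i _; rewrite mulr_ge0// prodr_ge0.
have -> : \sum_i p i * \prod_(l <- x :: J) h (z l + (i == l :> nat))%N =
    h (z x) * L - p ix * (h (z x) - h (z x).+1) * A.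
  rewrite mulr_sumr (bigD1 ix)//= [X in _ = X - _](bigD1 ix)//=.
  have E : \prod_(l <- J) h (z l + (ix == l :> nat))%N = A.
    apply: eq_big_seq => l lJ; rewrite ixx; case: eqP => [xl|]; rewrite ?addn0//.
    by move: xJ; rewrite xl lJ.
  rewrite big_cons E ixx eqxx addn1.
  rewrite (eq_bigr (fun i => h (z x) * (p i * \prod_(l <- J) h (z l + (i == l :> nat))%N))).
    by ring.
  move=> i iix; rewrite big_cons.
  have -> : (i == x :> nat) = false.
    by apply/eqP => ix'; move/eqP: iix; apply; apply/val_inj; rewrite /= ix' ixx.
  by rewrite addn0 mulrCA.
have d0 : 0 <= h (z x) - h (z x).+1 by rewrite subr_ge0.
have mx0 : 0 <= mix q h (z x) by exact: mix_ge0.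
apply: (@le_trans _ _ (mix q h (z x) * L)); last exact: ler_wpM2l.
have : q * (h (z x) - h (z x).+1) * L <= p ix * (h (z x) - h (z x).+1) * A.
  by apply: ler_pM => //; rewrite ?mulr_ge0// ler_wpM2r.
by rewrite /mix => hh; nra.
Qed.

(** Peels off the first half-edge. *)
Lemma sum_ffun_recl m (T : finType) (F : {ffun 'I_m.+1 -> T} -> R) :
  \sum_t F t = \sum_(i : T) \sum_(t : {ffun 'I_m -> T})
     F [ffun k => if unlift ord0 k is Some k' then t k' else i].
Proof.
rewrite pair_big/=.
pose f (u : T * {ffun 'I_m -> T}) : {ffun 'I_m.+1 -> T} :=
  [ffun k => if unlift ord0 k is Some k' then u.2 k' else u.1].
rewrite (reindex f)//=.
exists (fun t : {ffun 'I_m.+1 -> T} => (t ord0, [ffun k => t (lift ord0 k)])).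
  move=> [i t] _ /=; congr pair; first by rewrite ffunE unlift_none.
  by apply/ffunP => k; rewrite !ffunE liftK.
move=> t _; apply/ffunP => k; rewrite !ffunE /=.
by case: unliftP => [k' ->|->] //; rewrite ffunE.
Qed.

Lemma edges_le m n (p : 'I_n -> R) q (J : seq nat) (z : nat -> nat) (h : nat -> R) :
  (forall z, 0 <= h z) -> (forall z, h z.+1 <= h z) -> 0 <= q -> q <= 1 ->
  (forall i, 0 <= p i) -> \sum_i p i = 1 -> uniq J ->
  (forall l, l \in J -> exists2 i : 'I_n, i = l :> nat & q <= p i) ->
  \sum_(t : {ffun 'I_m -> 'I_n}) (\prod_k p (t k)) *
     \prod_(l <- J) h (z l + \sum_k (t k == l :> nat))%N
    <= \prod_(l <- J) iter m (mix q) h (z l).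
Proof.
move=> h0 hd q0 q1 p0 p1 uJ pJ.
elim: m z => [|m IH] z.
  rewrite [leLHS](eq_bigr (fun=> \prod_(l <- J) h (z l))) => [|t _]; last first.
    rewrite big_ord0 mul1r; apply: eq_bigr => l _.
    by rewrite big_ord0 addn0.
  by rewrite sumr_const card_ffun !card_ord expn0 mulr1n.
rewrite sum_ffun_recl.
have g0 : forall z, 0 <= iter m (mix q) h z.
  by elim: m {IH} => // m IHm y /=; apply: mix_ge0.
have gd : forall z, iter m (mix q) h z.+1 <= iter m (mix q) h z.
  by elim: m {IH g0} => // m IHm y; apply: mix_noninc.
apply: le_trans (one_edge_le z g0 gd q0 q1 p0 p1 uJ pJ).
apply: ler_sum => i _.
apply: (le_trans _ (ler_wpM2l (p0 i) (IH (fun l => z l + (i == l :> nat))%N))).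
rewrite mulr_sumr; rewrite le_eqVlt; apply/orP; left; apply/eqP; apply: eq_bigr => t _.
rewrite big_ord_recl ffunE unlift_none -!mulrA; congr (_ * (_ * _)).
  by apply: eq_bigr => k _; rewrite ffunE liftK.
apply: eq_bigr => l _; rewrite big_ord_recl ffunE unlift_none addnA; congr (h (_ + _)%N).
by apply: eq_bigr => k _; rewrite ffunE liftK.
Qed.

(** The number of hits of l is binomial; its generating function. *)
Lemma sum_edges_pow m n (p : 'I_n -> R) (s : R) (l : 'I_n) :
  \sum_i p i = 1 ->
  \sum_(t : {ffun 'I_m -> 'I_n}) (\prod_k p (t k)) * s ^+ (\sum_k (t k == l :> nat))%N
   = (1 + (s - 1) * p l) ^+ m.
Proof.
move=> p1.
have -> : 1 + (s - 1) * p l = \sum_i p i * s ^+ (i == l :> nat).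
  rewrite -[X in X + _]p1 (bigD1 l)//= [RHS](bigD1 l)//= eqxx expr1.
  rewrite [in RHS](eq_bigr p) => [|i il]; first by ring.
  have -> : (i == l :> nat) = false by apply/eqP => e; move/eqP: il; apply; exact/val_inj.
  by rewrite expr0 mulr1.
rewrite -[m in RHS]card_ord -prodr_const bigA_distr_bigA/=.
by apply: eq_bigr => t _; rewrite big_split/= expr_sum.
Qed.

(** The probability of still missing k, seen as a function of the current
    count, is harmonic for the chain of success_tail; the predecessor in its
    recursion matches the truncated difference k - z. *)
Lemma mix_success_tail (a : R) (s : seq R) (k z : nat) : 0 <= a ->
  mix (a / (1 + a)) (fun z => 1 - success_tail s (k - z)) z = 1 - success_tail (a :: s) (k - z).
Proof.
move=> a0; rewrite /mix /= -subnS.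
by field; lra.
Qed.

Lemma iter_mix_success_tail m (a : R) (s : seq R) (k z : nat) : 0 <= a ->
  iter m (mix (a / (1 + a))) (fun z => 1 - success_tail s (k - z)) z = 1 - success_tail (nseq m a ++ s) (k - z).
Proof.
move=> a0; elim: m z => // m IH z.
rewrite iterS -mix_success_tail//.
by rewrite /mix !IH.
Qed.

End edges.

(** * Tools from probability *)

Section prob.
Context {d : measure_display} {Omega : measurableType d} {R : realType}.
Variable P : probability Omega R.
Local Open Scope ereal_scope.

(** Borel-Cantelli for geometrically small probabilities. *)
Lemma ae_eventually_not (B : nat -> set Omega) (C r : R) (K : nat) :
  (forall k, measurable (B k)) -> (0 <= C)%R -> (0 <= r)%R -> (r < 1)%R ->
  (forall k, (K <= k)%N -> P (B k) <= (C * r ^+ k)%:E) ->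
  {ae P, forall w, exists K', forall k, (K' <= k)%N -> ~ B k w}.
Proof.
move=> mB C0 r0 r1 PB.
have h : P (lim_sup_set (fun k => B (k + K)%N)) = 0.
  apply: lim_sup_set_cvg0 => //.
  apply: (@le_lt_trans _ _ (\sum_(n <oo) (C * r ^+ n)%:E)).
    apply: lee_nneseries => // n _.
    apply: (le_trans (PB _ (leq_addl _ _))); rewrite lee_fin.
    by rewrite ler_wpM2l// exprD ler_piMr ?exprn_ge0// exprn_ile1// ltW.
  have -> : \sum_(n <oo) (C * r ^+ n)%:E = (limn (series (geometric C r)))%:E.
    rewrite -EFin_lim; last by apply: is_cvg_geometric_series; rewrite ger0_norm.
    congr (limn _); apply/funext => n.
    by rewrite /series /= sumEFin.
  exact: ltry.
exists (lim_sup_set (fun k => B (k + K)%N)); split => //.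
  by apply: bigcap_measurable => // k _; exact: bigcup_measurable.
move=> w /= nw n _.
apply: contrapT => nn; apply: nw; exists (n + K)%N => k nk Bk.
apply: nn; exists (k - K)%N => /=; first by lia.
by rewrite subnK//; lia.
Qed.

(** Independence on rectangles makes the joint law of X and Y a product measure,
    and the expectation factorises by Tonelli.  The absolute value inside only
    makes the integrand nonnegative on the whole plane. *)
Lemma integral_mul_indep (F : set (set Omega)) (X : {RV P >-> R}) (Y : Omega -> R)
    (phi : R -> R) :
  independent_of X F -> (forall C, measurable C -> F (Y @^-1` C)) ->
  measurable_fun setT Y -> measurable_fun setT phi ->
  (forall x, 0 <= phi x)%R -> (forall w, 0 <= Y w)%R ->
  \int[P]_w (phi (X w) * Y w)%:E = (\int[P]_w (phi (X w))%:E) * (\int[P]_w (Y w)%:E).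
Proof.
move=> iXF FY mY mphi phi0 Y0.
pose Ym : {RV P >-> R} := HB.pack_for {mfun Omega >-> R} Y (isMeasurableFun.Build _ _ _ _ Y mY).
have mZ : measurable_fun setT (fun w => (X w, Y w)) by apply: measurable_fun_pair.
pose Z : {mfun Omega >-> (R * R)%type} := HB.pack_for {mfun Omega >-> (R * R)%type}
  (fun w => (X w, Y w)) (isMeasurableFun.Build _ _ _ _ (fun w => (X w, Y w)) mZ).
pose f (u : R * R) : \bar R := (phi u.1 * `|u.2|)%:E.
have mf : measurable_fun [set: R * R] f.
  apply/measurable_EFinP; apply: measurable_funM.
    by apply: measurableT_comp => //; exact: measurable_fst.
  by apply: measurableT_comp => //; exact: measurable_snd.
have f0 u : 0 <= f u by rewrite lee_fin mulr_ge0.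
transitivity (\int[P]_w (f \o Z) w).
  by apply: eq_integral => w _; rewrite /f /= ger0_norm.
rewrite -ge0_integral_distribution//.
transitivity (\int[(distribution P X \x distribution P Ym)%E]_z f z).
  apply: eq_measure_integral => /= A mA _.
  apply/esym; apply: (@product_measure_unique _ _ _ _ _ (distribution P X) (distribution P Ym) (distribution P Z)) => //.
  move=> B C mB mC.
  by rewrite /distribution /pushforward /= -iXF//; exact: FY.
rewrite fubini_tonelli1// /fubini_F /=.
under eq_integral => x _.
  under eq_integral => y _ do rewrite /f/= EFinM.
  rewrite ge0_integralZl//; last 2 first.
    by apply/measurable_EFinP; exact: normr_measurable.
    by rewrite lee_fin.
  over.
rewrite ge0_integralZr//; last 3 first.
  exact/measurable_EFinP.
  by move=> x _; rewrite lee_fin.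
  by apply: integral_ge0 => y _; rewrite lee_fin.
rewrite !ge0_integral_distribution//; do ?[exact/measurable_EFinP | by apply/measurable_EFinP; exact: normr_measurable | by move=> y; rewrite lee_fin].
congr (_ * _); apply: eq_integral => w _ /=.
by rewrite ger0_norm.
Qed.
End prob.

Section measurable_comparison.
Context {d : measure_display} {T : measurableType d} {R : realType}.

Lemma measurable_set_lt (f g : T -> R) : measurable_fun setT f ->
  measurable_fun setT g -> measurable [set x | f x < g x].
Proof.
move=> mf mg; have := @measurable_fun_ltr _ _ _ setT f g mf mg measurableT [set true].
by rewrite setTI; exact.
Qed.

Lemma measurable_set_le (f g : T -> R) : measurable_fun setT f ->
  measurable_fun setT g -> measurable [set x | f x <= g x].
Proof.
move=> mf mg; have := @measurable_fun_ler _ _ _ setT f g mf mg measurableT [set true].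
by rewrite setTI; exact.
Qed.

End measurable_comparison.

Section markov_set.
Context {d : measure_display} {Omega : measurableType d} {R : realType}.
Variable P : probability Omega R.
Local Open Scope ereal_scope.

(** Markov's inequality. *)
Lemma measure_le_integral (A : set Omega) (Y : Omega -> R) (c : R) :
  measurable A -> measurable_fun setT Y -> (0 <= c)%R ->
  (forall w, A w -> c <= Y w)%R -> c%:E * P A <= \int[P]_(w in A) (Y w)%:E.
Proof.
move=> mA mY c0 cY; rewrite -integral_cst//.
apply: ge0_le_integral => //=; do ?[by move=> w Aw; rewrite lee_fin ?cY
  | by apply/measurable_EFinP; apply: measurable_funS mY].
Qed.

End markov_set.

Section exponential_estimates.
Context {R : realType}.

(** Half of the exponential rate absorbs a factor that is affine in k. *)
Lemma poly_expR_le (x y dlt : R) k : 0 <= x -> 0 <= y -> 0 < dlt ->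
  (x + y * k%:R) * expR (- dlt * k%:R) <= (x + 2 * y / dlt) * expR (- (dlt / 2)) ^+ k.
Proof.
move=> x0 y0 d0.
have -> : - dlt * k%:R = - (dlt / 2) * k%:R + - (dlt / 2) * k%:R by field.
rewrite expRD -expRM_natr mulrA; apply: ler_wpM2r; first exact: expR_ge0.
rewrite mulNr expRN ler_pdivrMr ?expR_gt0//.
have k0 : 0 <= k%:R :> R by [].
have dk0 : 0 <= dlt / 2 * k%:R by rewrite mulr_ge0// ltW// divr_gt0.
apply: (@le_trans _ _ ((x + 2 * y / dlt) * (1 + dlt / 2 * k%:R))); last first.
  apply: ler_wpM2l; last exact: expR_ge1Dx.
  by rewrite addr_ge0// divr_ge0 ?mulr_ge0// ltW.
have -> : (x + 2 * y / dlt) * (1 + dlt / 2 * k%:R) =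
   x + y * k%:R + (x * (dlt / 2 * k%:R) + 2 * y / dlt) by field; rewrite gt_eqF.
rewrite lerDl; apply: addr_ge0; first exact: mulr_ge0.
by apply: divr_ge0; [exact: mulr_ge0 | exact: ltW].
Qed.

End exponential_estimates.

(** * A law of large numbers for the weights *)

Section wrg_lln.
Context {d : measure_display} {Omega : measurableType d} {R : realType}.
Variables (P : probability Omega R) (m : nat) (V : {RV P >-> R}).
Variables (W : nat -> {RV P >-> R}) (E : nat -> 'I_m -> {RV P >-> nat}).
Hypothesis G : is_WRG W E V.

Definition wrg_gen (a b : nat) : set (set Omega) :=
  ((\bigcup_(i in [set i | (i < a)%N]) g_sigma_algebra_preimage (W i))
      `|` (\bigcup_(j in [set j | (0 < j < b)%N])
             \bigcup_(k in [set: 'I_m]) g_sigma_algebra_preimage (E j k))).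

(** The sample space with the past as its sigma-algebra: measurability of sets
    with respect to the past becomes ordinary measurability on this type. *)
Definition wrgT a b := g_sigma_algebraType (wrg_gen a b).

Lemma measurable_W a b i : (i < a)%N ->
  measurable_fun [set: wrgT a b] (W i : wrgT a b -> R).
Proof.
move=> ia _ B mB; rewrite setTI; apply: sub_sigma_algebra; left.
by exists i => //; exists B => //; rewrite setTI.
Qed.

Lemma measurable_E a b j k : (0 < j < b)%N ->
  measurable_fun [set: wrgT a b] (E j k : wrgT a b -> nat).
Proof.
move=> jb _ B mB; rewrite setTI; apply: sub_sigma_algebra; right.
by exists j => //; exists k => //; exists B => //; rewrite setTI.
Qed.

Lemma wrg_sigma_measurable a b A : wrg_sigma W E a b A -> measurable A.
Proof.
move=> h; apply: h; split; first exact: sigma_algebra_measurable.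
move=> B [[i _ [C mC <-]]|[j _ [k _ [C mC <-]]]]; exact: measurable_funP.
Qed.

Lemma measurable_wrgT {d'} {U : measurableType d'} a b (f : Omega -> U) :
  measurable_fun [set: wrgT a b] (f : wrgT a b -> U) -> measurable_fun setT f.
Proof.
move=> mf _ B mB; apply: (@wrg_sigma_measurable a b).
exact: mf.
Qed.

Local Open Scope ereal_scope.

Lemma integral_same_law i (phi : R -> R) : measurable_fun setT phi ->
  (forall x, 0 <= phi x)%R ->
  \int[P]_w (phi (W i w))%:E = \int[P]_w (phi (V w))%:E.
Proof.
move=> mphi phi0.
have h (X : {RV P >-> R}) : \int[P]_w (phi (X w))%:E = \int[distribution P X]_x (phi x)%:E.
  by rewrite ge0_integral_distribution//; exact/measurable_EFinP.
rewrite !h; apply: eq_measure_integral => A mA _.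
exact: (wrg_same_law G).
Qed.

Lemma measurable_prod_W a b n (phi : R -> R) : (n <= a)%N -> measurable_fun setT phi ->
  measurable_fun [set: wrgT a b] (fun w : wrgT a b => (\prod_(i < n) phi (W i w))%R).
Proof.
move=> na mphi; apply: measurable_prod => i _.
apply: measurableT_comp => //; apply: measurable_W.
exact: leq_trans (ltn_ord i) na.
Qed.

(** The weight of a new vertex is independent of the past, hence of the product
    over the earlier vertices. *)
Lemma integral_prod_W (phi : R -> R) (M : R) n : measurable_fun setT phi ->
  (forall x, 0 <= phi x)%R -> \int[P]_w (phi (V w))%:E = M%:E ->
  \int[P]_w (\prod_(i < n) phi (W i w))%:E = (M ^+ n)%:E.
Proof.
move=> mphi phi0 hM; elim: n => [|n IH].
  rewrite (eq_integral (cst 1)) => [|w _]; last by rewrite big_ord0.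
  by rewrite integral_cst// mul1e expr0; exact: probability_setT.
rewrite (eq_integral (fun w => (phi (W n w) * \prod_(i < n) phi (W i w))%:E)) => [|w _]; last first.
  by rewrite big_ord_recr mulrC.
case: n IH => [|n] IH.
  rewrite (eq_integral (fun w => (phi (W 0%N w))%:E)) => [|w _]; last by rewrite big_ord0 mulr1.
  by rewrite integral_same_law// hM.
have mp := @measurable_prod_W n.+1 n.+2 n.+1 phi (leqnn _) mphi.
rewrite (@integral_mul_indep _ _ _ _ _ _ _ _ (wrg_fresh G (ltn0Sn n)))//.
- by rewrite integral_same_law// hM IH -EFinM -exprS.
- by move=> C mC; have := mp measurableT C mC; rewrite setTI.
- exact: measurable_wrgT mp.
- by move=> w; rewrite prodr_ge0.
Qed.

Lemma expR_le_quad (x : R) : (0 <= x)%R -> (x <= 1 / 2)%R -> (expR x <= 1 + x + 2 * x ^+ 2)%R.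
Proof.
move=> x0 x1; have h := expR_ge1Dx (- x).
have h1 : (expR x * (1 - x) <= 1)%R.
  apply: (le_trans (ler_wpM2l (expR_ge0 x) h)).
  by rewrite -expRD subrr expR0.
have : (1 <= (1 + x + 2 * x ^+ 2) * (1 - x))%R by nra.
move=> h2; have x2 : (0 < 1 - x)%R by lra.
by rewrite -(ler_pM2r x2); apply: le_trans h2.
Qed.

(** One half of the strong law of large numbers, by Chernoff's bound: for values
    in [0, 1] and small t the exponential moment is at most
    exp (t nu + 2 t ^ 2), and the probability of a deviation is geometrically
    small.  The other half follows by applying it to 1 - f. *)
Lemma ae_eventually_sum_le (f : R -> R) (nu eps : R) : measurable_fun setT f ->
  (forall x, 0 <= f x <= 1)%R -> \int[P]_w (f (V w))%:E = nu%:E -> (0 < eps)%R ->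
  {ae P, forall w, exists N, forall n, (N <= n)%N ->
     (\sum_(i < n) f (W i w) <= n%:R * (nu + eps))%R}.
Proof.
move=> mf f01 hnu eps0.
pose e := (Num.min eps 1)%R.
have e0 : (0 < e)%R by rewrite lt_min eps0 ltr01.
have e1 : (e <= 1)%R by rewrite ge_min lexx orbT.
have ee : (e <= eps)%R by rewrite ge_min lexx.
(* The minimiser of 2 t ^ 2 - t e, with value - e ^ 2 / 8; since e <= 1 it
   stays in the range of expR_le_quad. *)
pose t : R := (e / 4)%R.
pose phi x := expR (t * f x).
have mphi : measurable_fun setT phi.
  apply: measurableT_comp; first exact: measurable_expR.
  exact: measurable_funM.
have phi0 x : (0 <= phi x)%R by exact: expR_ge0.
have [M [hM M0 Mle]] : exists M : R, [/\ \int[P]_w (phi (V w))%:E = M%:E, (0 <= M)%R &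
    (M <= expR (t * nu + 2 * t ^+ 2))%R].
  have h : \int[P]_w (phi (V w))%:E <= (1 + t * nu + 2 * t ^+ 2)%:E.
    apply: (@le_trans _ _ (\int[P]_w ((1 + 2 * t ^+ 2)%:E + t%:E * (f (V w))%:E))).
      apply: ge0_le_integral => //.
      - by move=> w _; rewrite lee_fin.
      - by apply/measurable_EFinP; apply: measurableT_comp.
      - apply: emeasurable_funD => //; apply: emeasurable_funM => //.
        by apply/measurable_EFinP; apply: measurableT_comp.
      - move=> w _; rewrite -EFinM -EFinD lee_fin; have /andP[f0 f1] := f01 (V w).
        have t0 : (0 < t)%R by rewrite divr_gt0.
        apply: (le_trans (expR_le_quad _ _)); rewrite /t; [by rewrite mulr_ge0// ltW|by nra|].
        have : ((t * f (V w)) ^+ 2 <= t ^+ 2)%R.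
          by rewrite exprMn ler_piMr ?sqr_ge0// exprn_ile1.
        rewrite -/t; lra.
    rewrite ge0_integralD//; last 3 first.
    - by move=> w _; rewrite lee_fin addr_ge0// mulr_ge0 ?sqr_ge0.
    - move=> w _; rewrite -EFinM lee_fin; have /andP[? ?] := f01 (V w).
      by rewrite mulr_ge0// divr_ge0// ltW.
    - apply: emeasurable_funM => //.
      by apply/measurable_EFinP; apply: measurableT_comp.
    have I1 : \int[P]_w (1 + 2 * t ^+ 2)%:E = (1 + 2 * t ^+ 2)%:E.
      etransitivity; first exact: integral_cst.
      by rewrite -[RHS]mule1; congr (_ * _); exact: probability_setT.
    rewrite I1 ge0_integralZl//; last 3 first.
    - by apply/measurable_EFinP; apply: measurableT_comp.
    - by move=> w _; rewrite lee_fin; have /andP[] := f01 (V w).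
    - by rewrite lee_fin divr_ge0// ltW.
    by rewrite hnu -EFinM -EFinD lee_fin; lra.
  have i0 : 0 <= \int[P]_w (phi (V w))%:E by apply: integral_ge0 => w _; rewrite lee_fin.
  exists (fine (\int[P]_w (phi (V w))%:E)); split.
  - by rewrite fineK// ge0_fin_numE// (le_lt_trans h)// ltry.
  - exact: fine_ge0.
  - apply: le_trans (expR_ge1Dx _); rewrite addrA -lee_fin fineK//.
    by rewrite ge0_fin_numE// (le_lt_trans h)// ltry.
pose B n := [set w | (n%:R * (nu + e) < \sum_(i < n) f (W i w))%R].
have mS n : measurable_fun setT (fun w => (\sum_(i < n) f (W i w))%R).
  by apply: measurable_sum => i; apply: measurableT_comp.
have mB n : measurable (B n).
  exact: measurable_set_lt.
have := @ae_eventually_not _ _ _ P B 1 (expR (- (e ^+ 2 / 8))) 0 mB ler01 (expR_ge0 _).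
rewrite -[X in (_ < X)%R]expR0 ltr_expR oppr_lt0 divr_gt0// ?exprn_gt0// => /(_ isT) H.
have {}H : {ae P, forall w, exists K' : nat, forall k : nat, (K' <= k)%N -> ~ B k w}.
  apply: H => n _.
  pose L := expR (t * (n%:R * (nu + e))).
  have L0 : (0 < L)%R by exact: expR_gt0.
  have h1 : L%:E * P (B n) <= (M ^+ n)%:E.
    rewrite -(integral_prod_W n mphi phi0 hM).
    have mp : measurable_fun setT (fun w => (\prod_(i < n) phi (W i w))%R).
      exact: (measurable_wrgT (@measurable_prod_W n n n phi (leqnn _) mphi)).
    apply: le_trans (@measure_le_integral _ _ _ P (B n) (fun w => (\prod_(i < n) phi (W i w))%R) L _ _ (ltW L0) _) _ => //.
    - move=> w /= /ltW Bw; rewrite -expR_sum -mulr_sumr ler_expR.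
      by apply: ler_wpM2l => //; rewrite divr_ge0// ltW.
    - apply: ge0_subset_integral => //; first exact/measurable_EFinP.
      by move=> w _; rewrite lee_fin prodr_ge0.
  rewrite mul1r; rewrite -lee_pdivlMl// in h1.
  apply: (le_trans h1).
  rewrite -EFinM lee_fin mulrC ler_pdivrMr//.
  apply: (@le_trans _ _ (expR (t * nu + 2 * t ^+ 2) ^+ n)%R).
    by apply: lerXn2r; rewrite ?nnegrE// expR_ge0.
  rewrite -!expRM_natr -expRD ler_expR /t.
  by rewrite le_eqVlt; apply/orP; left; apply/eqP; field.
apply: filterS H => w [N HN]; exists N => n Nn.
have := HN n Nn; rewrite /B /= => /negP; rewrite -leNgt => h.
by apply: (le_trans h); apply: ler_wpM2l => //; rewrite lerD2l.
Qed.

End wrg_lln.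

(** * One step of the graph *)

Section wrg_step.
Context {d : measure_display} {Omega : measurableType d} {R : realType}.
Variables (P : probability Omega R) (m : nat) (V : {RV P >-> R}).
Variables (W : nat -> {RV P >-> R}) (E : nat -> 'I_m -> {RV P >-> nat}).
Hypothesis G : is_WRG W E V.
Variable a : R.

(** Equality of what the proof observes of the first n vertices: their edges, and
    which of them have weight at least a.  These observations take countably
    many values, unlike the weights themselves. *)
Definition same_state (n : nat) (w w' : Omega) : Prop :=
  (forall j k, (0 < j < n)%N -> E j k w = E j k w') /\
  (forall i, (i < n)%N -> (a <= W i w) = (a <= W i w')).

Definition edge_obs (n : nat) (w : Omega) : seq nat :=
  [seq E u.1 u.2 w : nat | u <- [seq (j, k) | j <- iota 1 n.-1, k <- enum 'I_m]].

Definition weight_obs (n : nat) (w : Omega) : seq nat :=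
  [seq nat_of_bool (a <= W i w) | i <- iota 0 n].

Definition state_code (n : nat) (w : Omega) : nat :=
  choice.pickle (edge_obs n w, weight_obs n w).

Lemma state_codeP n w w' : state_code n w = state_code n w' ->
  edge_obs n w = edge_obs n w' /\ weight_obs n w = weight_obs n w'.
Proof. by move=> /(pcan_inj choice.pickleK)[-> ->]. Qed.

Lemma state_code_same n w w' : state_code n w = state_code n w' -> same_state n w w'.
Proof.
move=> /state_codeP[/eq_in_map h1 /eq_in_map h2]; split.
- move=> j k jn; apply: (h1 (j, k)); apply/allpairsP; exists (j, k) => /=.
  by rewrite mem_iota mem_enum; split => //; lia.
- move=> i ni; have := h2 i; rewrite mem_iota ni => /(_ isT).
  by case: (a <= W i w); case: (a <= W i w').
Qed.

Lemma measurable_map_seq {d'} {T : measurableType d'} {I : eqType} (s : seq I)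
    (F : I -> T -> nat) (l : seq nat) :
  (forall i, i \in s -> measurable_fun setT (F i)) ->
  measurable [set w | [seq F i w | i <- s] = l].
Proof.
elim: s l => [|x s IH] [|y l] mF /=.
- by rewrite (_ : [set _ | _] = setT)//; apply/seteqP; split.
- by rewrite (_ : [set _ | _] = set0)//; apply/seteqP; split.
- by rewrite (_ : [set _ | _] = set0)//; apply/seteqP; split.
rewrite (_ : [set _ | _] = F x @^-1` [set y] `&` [set w | [seq F i w | i <- s] = l]).
  apply: measurableI; last by apply: IH => i si; apply: mF; rewrite inE si orbT.
  by have := mF x (mem_head _ _) measurableT [set y]; rewrite setTI; exact.
by apply/seteqP; split => [w /= [-> ->]|w /= [-> ->]].
Qed.

Lemma measurable_state_code n u : wrg_sigma W E n n [set w | state_code n w = u].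
Proof.
case: (pselect (exists w, state_code n w = u)) => [[w0 <-]|nu]; last first.
  rewrite (_ : [set _ | _] = set0); first exact: sigma_algebra0.
  by apply/seteqP; split => w //= h; apply: nu; exists w.
rewrite (_ : [set w | _] = [set w | edge_obs n w = edge_obs n w0] `&`
    [set w | weight_obs n w = weight_obs n w0]); last first.
  by apply/seteqP; split => w /=; [move/state_codeP|rewrite /state_code => -[-> ->]].
apply: (@measurableI _ (wrgT W E n n)).
- apply: (@measurable_map_seq _ (wrgT W E n n) _ _ (fun u (w : wrgT W E n n) => E u.1 u.2 w)).
  move=> [j k] /allpairsP[[j' k'] /= [+ _ [-> ->]]]; rewrite mem_iota => jn.
  by apply: measurable_E; lia.
- apply: (@measurable_map_seq _ (wrgT W E n n) _ _ (fun i (w : wrgT W E n n) => nat_of_bool (a <= W i w))).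
  move=> i; rewrite mem_iota => ni.
  apply: measurableT_comp => //; apply: measurable_fun_ler => //.
  by apply: measurable_W; lia.
Qed.

Arguments measurable_state_code : clear implicits.

Lemma wrg_sigma_state n (A : set Omega) :
  (forall w w', same_state n w w' -> A w -> A w') -> wrg_sigma W E n n A.
Proof.
move=> sA.
rewrite (_ : A = \bigcup_(u in [set u | exists2 w, state_code n w = u & A w]) [set w | state_code n w = u]).
  by apply: (@bigcup_measurable _ (wrgT W E n n)) => u _; exact: (measurable_state_code n u).
apply/seteqP; split => w /=; first by move=> Aw; exists (state_code n w) => //; exists w.
by move=> [u [w' <- Aw']] /= /esym/state_code_same/sA; apply.
Qed.

(** Every function of the observations is measurable, because these have
    countably many values. *)
Lemma measurable_state {d'} {U : measurableType d'} n (f : Omega -> U) :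
  (forall w w', same_state n w w' -> f w = f w') -> measurable_fun setT f.
Proof.
move=> sf _ B mB; rewrite setTI; apply: (@wrg_sigma_measurable _ _ _ _ _ W E n n).
by apply: wrg_sigma_state => w w' /sf /= ->.
Qed.

Local Open Scope ereal_scope.

(** Comparison of expectations over one step.  On an atom of the observations K
    and H are constant, so the integral of K' is a finite sum over the possible
    targets t of H t times the probability of t, which the definition of the
    graph gives as an integral of the product of the W (t k) / S_n; the
    pointwise inequality can then be integrated back. *)
Lemma wrg_step_le n (A : set Omega) (H : Omega -> {ffun 'I_m -> 'I_n} -> R)
    (K K' : Omega -> R) : (0 < n)%N -> wrg_sigma W E n n A ->
  (forall w w', same_state n w w' -> K w = K w') ->
  (forall w w' t, same_state n w w' -> H w t = H w' t) ->
  measurable_fun setT K' ->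
  (forall w, 0 <= K w)%R -> (forall w t, 0 <= H w t)%R ->
  (forall w (t : {ffun 'I_m -> 'I_n}), (forall k, E n k w = t k :> nat) -> K' w = H w t) ->
  (forall w (i : 'I_n), A w -> 0 <= W i w / total_weight W n w)%R ->
  (forall w, A w ->
     \sum_(t : {ffun 'I_m -> 'I_n}) (\prod_k (W (t k) w / total_weight W n w)) * H w t <= K w)%R ->
  \int[P]_(w in A) (K' w)%:E <= \int[P]_(w in A) (K w)%:E.
Proof.
move=> n0 FA sK sH mK' K0 H0 K'H p0 le.
have mA := wrg_sigma_measurable FA.
have K'0 w : (0 <= K' w)%R.
  have ok k : (E n k w < n)%N by exact: (wrg_range G).
  by rewrite (K'H w [ffun k => Ordinal (ok k)]) => // k; rewrite ffunE.
have mK := measurable_state sK.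
(* the atoms of A *)
pose Au u := A `&` [set w | state_code n w = u].
have FAu u : wrg_sigma W E n n (Au u).
  by apply: (@measurableI _ (wrgT W E n n)) => //; exact: measurable_state_code.
have mAu u : measurable (Au u) := wrg_sigma_measurable (FAu u).
have AE : A = \bigcup_u Au u.
  by apply/seteqP; split => [w Aw|w [u _ []]//]; exists (state_code n w).
have tA : trivIset setT Au.
  by apply/trivIsetP => u v _ _ /eqP uv; apply/seteqP; split => w //= [[_ /= wu] [_ /= wv]]; apply: uv; rewrite -wu -wv.
have mKE D : measurable_fun D (fun w => (K w)%:E).
  by apply/measurable_EFinP; apply: measurable_funTS.
have mKE' D : measurable_fun D (fun w => (K' w)%:E).
  by apply/measurable_EFinP; apply: measurable_funTS.
rewrite {1 2}AE !ge0_integral_bigcup//; do ?[by move=> w _; rewrite lee_fin].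
apply: lee_nneseries => [u _ _|u _]; first by apply: integral_ge0 => w _; rewrite lee_fin.
have [->|/set0P[w0 [Aw0 cw0]]] := eqVneq (Au u) set0; first by rewrite !integral_set0.
have same w : Au u w -> same_state n w w0.
  by move=> [_ cw]; apply: state_code_same; rewrite cw cw0.
pose B (t : {ffun 'I_m -> 'I_n}) := [set w | forall k, E n k w = t k :> nat].
have mB t : measurable (B t).
  rewrite (_ : B t = \bigcap_(k in [set: 'I_m]) (E n k @^-1` [set (t k : nat)])).
    by apply: fin_bigcap_measurable => // k _; rewrite -[X in measurable X]setTI; exact: measurable_funP.
  by apply/seteqP; split => w /= h k; [move=> _; exact: h | exact: (h k I)].
pose p (t : {ffun 'I_m -> 'I_n}) w := (\prod_k (W (t k) w / total_weight W n w))%R.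
have PB t : P (Au u `&` B t) = \int[P]_(w in Au u) (p t w)%:E.
  by have [_ _ ->] := wrg_edges G t n0.
have mp t D : measurable_fun D (fun w => (p t w)%:E).
  have [_ /integrableP[/= h _] _] := wrg_edges G t n0.
  exact: measurable_funTS h.
apply: (@le_trans _ _ (\int[P]_(w in Au u) \sum_(t : {ffun 'I_m -> 'I_n}) (p t w * H w0 t)%:E)).
  rewrite ge0_integral_sum//; last 2 first.
  - by move=> t; rewrite -/(p t); under eq_fun do rewrite EFinM; apply: emeasurable_funM.
  - move=> t w [Aw _]; rewrite lee_fin mulr_ge0// prodr_ge0// => k _; exact: p0.
  apply: (@le_trans _ _ (\int[P]_(w in Au u) \sum_(t : {ffun 'I_m -> 'I_n}) (H w0 t * \1_(B t) w)%:E)).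
    rewrite le_eqVlt; apply/orP; left; apply/eqP; apply: eq_integral => w /[!inE] Auw.
    have ok k : (E n k w < n)%N by exact: (wrg_range G).
    pose tw : {ffun 'I_m -> 'I_n} := [ffun k => Ordinal (ok k)].
    have Btw : B tw w by move=> k; rewrite ffunE.
    rewrite sumEFin (bigD1 tw)//= indicE mem_set// mulr1 big1 ?addr0 => [|t ttw].
      by rewrite (K'H w tw)// (sH w w0)//; exact: same.
    rewrite indicE memNset ?mulr0// => Bt; move/eqP: ttw; apply; apply/ffunP => k.
    by apply: val_inj; rewrite /= -Bt Btw.
  rewrite ge0_integral_sum//; last 2 first.
  - by move=> t; apply/measurable_EFinP; apply: measurable_funM => //.
  - by move=> t w _; rewrite lee_fin mulr_ge0.
  apply: lee_sum => t _.
  have -> : \int[P]_(w in Au u) (p t w * H w0 t)%:E = (H w0 t)%:E * P (Au u `&` B t).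
    rewrite PB -ge0_integralZl//; last 2 first.
    - by move=> w [Aw _]; rewrite lee_fin prodr_ge0// => k _; exact: p0.
    - by rewrite lee_fin.
    by apply: eq_integral => w _; rewrite -EFinM mulrC.
  under eq_integral do rewrite EFinM.
  rewrite ge0_integralZl//; do ?[by move=> w _; rewrite lee_fin | by rewrite lee_fin
    | by apply/measurable_EFinP].
  by rewrite integral_indic// setIC.
apply: ge0_le_integral => //.
- by move=> w [Aw _]; apply: sume_ge0 => t _; rewrite lee_fin mulr_ge0// prodr_ge0// => k _; exact: p0.
- apply: emeasurable_sum => t; under eq_fun do rewrite EFinM; exact: emeasurable_funM.
- move=> w Auw; rewrite sumEFin lee_fin; apply: le_trans (le w _); last by case: Auw.
  by apply: ler_sum => t _; rewrite (sH w w0 t)//; exact: same.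
Qed.
End wrg_step.

(** * Law of the weights *)

Section weight_law.
Context {d : measure_display} {Omega : measurableType d} {R : realType}.
Variables (P : probability Omega R) (m : nat) (V : {RV P >-> R}).
Variables (W : nat -> {RV P >-> R}) (E : nat -> 'I_m -> {RV P >-> nat}).
Hypotheses (V_ge0 : forall w, 0 <= V w) (V_endpoint : upper_endpoint V = 1%E).
Hypothesis G : is_WRG W E V.

Local Open Scope ereal_scope.

Lemma probability_gt x : P [set w | (x < V w)%R] = 1 - cdf V x.
Proof.
have := cdf_ccdf_1 V x => <-.
rewrite [X in X - _]addeC addeK ?fin_num_measure//.
congr (P _); apply/seteqP; split => w /=; rewrite in_itv/= andbT//.
Qed.

(** Above the upper endpoint the distribution function is 1. *)
Lemma probability_V_gt1 : P [set w | (1 < V w)%R] = 0.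
Proof.
rewrite (_ : [set w | _] = \bigcup_n [set w | (1 + n.+1%:R^-1 < V w)%R]); last first.
  apply/seteqP; split => w /=.
    move=> V1; have e0 : (0 < V w - 1)%R by rewrite subr_gt0.
    exists (Num.truncn (V w - 1)^-1) => //=.
    rewrite -ltrBrDl invf_plt ?posrE ?ltr0n//; exact: truncnS_gt.
  by move=> [n _ /=]; apply: le_lt_trans; rewrite lerDl invr_ge0.
apply/eqP; rewrite -measure_le0.
apply: (le_trans (@measure_sigma_subadditive _ _ _ P _ (fun n => [set w | (1 + n.+1%:R^-1 < V w)%R]) _ _ (@subset_refl _ _))) => //.
- by move=> n; apply: measurable_set_lt.
- by apply: bigcup_measurable => n _; apply: measurable_set_lt.
rewrite eseries0// => n _ _; rewrite /= probability_gt.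
have [c1|] := eqVneq (cdf V (1 + n.+1%:R^-1)) 1; first by rewrite c1 subee.
move=> cn1; exfalso.
have c1 : cdf V (1 + n.+1%:R^-1) < 1 by rewrite lt_neqAle cn1 cdf_le1.
have : (1 + n.+1%:R^-1)%:E <= upper_endpoint V by apply: ereal_sup_ubound; exists (1 + n.+1%:R^-1)%R.
by rewrite V_endpoint lee_fin gerDl leNgt invr_gt0 ltr0n.
Qed.

(** Below the upper endpoint the distribution function is still less than 1. *)
Lemma probability_V_ge (a : R) : (a < 1)%R -> 0 < P [set w | (a <= V w)%R].
Proof.
move=> a1.
have : a%:E < upper_endpoint V by rewrite V_endpoint lte_fin.
move=> /ereal_sup_gt[_ [x /= cx <-]]; rewrite lte_fin => ax.
apply: (@lt_le_trans _ _ (P [set w | (x < V w)%R])).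
  by rewrite probability_gt sube_gt0.
apply: le_measure; rewrite ?inE.
- exact: measurable_set_lt.
- exact: measurable_set_le.
- by move=> w /= xV; apply: ltW; exact: lt_trans xV.
Qed.

(** Weights lie in [0, 1] only almost surely; truncating them makes bounded
    functions of the weights to which the law of large numbers applies. *)
Definition clip (x : R) : R := Num.max 0%R (Num.min x 1%R).

Lemma clip_itv x : (0 <= clip x <= 1)%R.
Proof. by rewrite /clip le_max lexx/= ge_max ler01 ge_min lexx orbT. Qed.

Lemma clip_id x : (0 <= x <= 1)%R -> clip x = x.
Proof. by rewrite /clip => /andP[x0 x1]; rewrite min_l// max_r. Qed.

Lemma measurable_clip : measurable_fun setT clip.
Proof. by apply: measurable_maxr => //; apply: measurable_minr. Qed.

Let mu : R := fine 'E_P[V].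

Lemma ae_V_le1 : {ae P, forall w, (V w <= 1)%R}.
Proof.
exists [set w | (1 < V w)%R]; split; [exact: measurable_set_lt|exact: probability_V_gt1|].
by move=> w /= /negP; rewrite -ltNge.
Qed.

Lemma integral_clip_V : \int[P]_w (clip (V w))%:E = mu%:E.
Proof.
have E1 : 'E_P[V] = \int[P]_w (clip (V w))%:E.
  rewrite unlock; apply: ae_eq_integral => //.
  - exact/measurable_EFinP.
  - by apply/measurable_EFinP; apply: measurableT_comp => //; exact: measurable_clip.
  - apply: filterS ae_V_le1 => w V1 _.
    by rewrite clip_id// V_ge0.
rewrite -E1 fineK// E1 ge0_fin_numE; last first.
  by apply: integral_ge0 => w _; rewrite lee_fin; have /andP[] := clip_itv (V w).
apply: (@le_lt_trans _ _ (\int[P]_w (cst 1 w))).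
  apply: ge0_le_integral => //.
  - by move=> w _; rewrite lee_fin; have /andP[] := clip_itv (V w).
  - by apply/measurable_EFinP; apply: measurableT_comp => //; exact: measurable_clip.
  - by move=> w _; rewrite lee_fin; have /andP[] := clip_itv (V w).
rewrite integral_cst// mul1e.
by apply: le_lt_trans (ltry 1); exact: probability_le1.
Qed.

(** Weights at least 1 / 2 have positive probability. *)
Lemma mu_gt0 : (0 < mu)%R.
Proof.
rewrite -lte_fin -integral_clip_V.
have h : (1 / 2 < 1 :> R)%R by lra.
have := probability_V_ge h; set A := [set w | _] => PA.
have mA : measurable A by exact: measurable_set_le.
have mc : measurable_fun setT (fun w => clip (V w)).
  by apply: measurableT_comp => //; exact: measurable_clip.
have hA : (1 / 2 : R)%:E * P A <= \int[P]_(w in A) (clip (V w))%:E.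
  apply: measure_le_integral => //.
  by move=> w /= hw; rewrite /clip le_max le_min hw/=; apply/orP; right; lra.
apply: (@lt_le_trans _ _ ((1 / 2 : R)%:E * P A)).
  by rewrite mule_gt0// lte_fin; lra.
apply: (le_trans hA); apply: ge0_subset_integral => //.
- exact/measurable_EFinP.
- by move=> w _; rewrite lee_fin; have /andP[] := clip_itv (V w).
Qed.

Lemma ae_weights : {ae P, forall w, forall i, (0 <= W i w <= 1)%R}.
Proof.
apply: ae_foralln => i.
have mB : measurable (~` `[0%R, 1%R]%classic : set R) by apply: measurableC.
exists (W i @^-1` (~` `[0%R, 1%R])); split.
- by rewrite -[X in measurable X]setTI; exact: measurable_funP.
- etransitivity; first exact: (wrg_same_law G i mB).
  apply/eqP; rewrite -measure_le0 -probability_V_gt1.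
  apply: le_measure; rewrite ?inE.
  + by rewrite -[X in measurable X]setTI; exact: measurable_funP.
  + exact: measurable_set_lt.
  + by move=> w /=; rewrite in_itv/= V_ge0/= => /negP; rewrite -ltNge.
- by move=> w /=; rewrite in_itv.
Qed.

Lemma ae_total_weight_le (b : R) : (mu < b)%R ->
  {ae P, forall w, exists N, forall n, (N <= n)%N -> (total_weight W n w <= b * n%:R)%R}.
Proof.
move=> mub.
have := @ae_eventually_sum_le _ _ _ P m V W E G clip mu (b - mu)%R measurable_clip clip_itv integral_clip_V.
rewrite subr_gt0 => /(_ mub) H.
apply: filterS2 ae_weights H => w ok [N HN]; exists N => n Nn.
have := HN n Nn; rewrite addrC subrK mulrC.
by under eq_bigr do rewrite clip_id//.
Qed.

Lemma ae_total_weight_ge (b : R) : (b < mu)%R ->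
  {ae P, forall w, exists N, forall n, (N <= n)%N -> (b * n%:R <= total_weight W n w)%R}.
Proof.
move=> mub.
have mc : measurable_fun setT (fun x => 1 - clip x)%R.
  by apply: measurable_funB => //; exact: measurable_clip.
have c01 x : (0 <= 1 - clip x <= 1)%R by have /andP[? ?] := clip_itv x; lra.
have ic : \int[P]_w (1 - clip (V w))%:E = (1 - mu)%:E.
  have h : \int[P]_w (1 - clip (V w))%:E + mu%:E = 1.
    rewrite -integral_clip_V -ge0_integralD//.
    - under eq_integral do rewrite -EFinD subrK.
      by rewrite integral_cst// mul1e; exact: probability_setT.
    - by move=> w _; rewrite lee_fin; have /andP[] := c01 (V w).
    - by apply/measurable_EFinP; apply: measurable_funB => //; apply: measurableT_comp => //; exact: measurable_clip.
    - by move=> w _; rewrite lee_fin; have /andP[] := clip_itv (V w).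
    - by apply/measurable_EFinP; apply: measurableT_comp => //; exact: measurable_clip.
  by rewrite EFinB -h addeK.
have := @ae_eventually_sum_le _ _ _ P m V W E G _ _ (mu - b)%R mc c01 ic.
rewrite subr_gt0 => /(_ mub) H.
apply: filterS2 ae_weights H => w ok [N HN]; exists N => n Nn.
have := HN n Nn; rewrite addrA subrK.
under eq_bigr do rewrite clip_id//.
rewrite sumrB sumr_const card_ord -/(total_weight W n w) mulrBr mulr1 => h.
by rewrite [(b * _)%R]mulrC; lra.
Qed.

(** The law of large numbers applied to the indicator of a weight below a. *)
Lemma ae_heavy_ge (a : R) : (a < 1)%R -> exists2 rho : R, (0 < rho)%R &
  {ae P, forall w, exists N, forall n, (N <= n)%N ->
    (rho * n%:R <= (\sum_(i < n) (a <= W i w)%R)%:R)%R}.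
Proof.
move=> a1; have := probability_V_ge a1; set A := [set w | _] => PA.
have mA : measurable A by exact: measurable_set_le.
pose p := fine (P A).
have PAE : P A = p%:E by rewrite fineK// fin_num_measure.
have p0 : (0 < p)%R by rewrite -lte_fin -PAE.
have mset : measurable [set x : R | (x < a)%R] by apply: measurable_set_lt.
pose f (x : R) : R := \1_[set x : R | (x < a)%R] x.
have mf : measurable_fun setT f by exact: measurable_indic.
have f01 x : (0 <= f x <= 1)%R by rewrite /f indicE; case: (_ \in _) => /=; rewrite lexx ler01.
have iF : \int[P]_w (f (V w))%:E = (1 - p)%:E.
  rewrite EFinB -PAE -probability_setC//.
  have -> : ~` A = [set w | (V w < a)%R].
    by apply/seteqP; split => w /=; [move=> /negP; rewrite -ltNge|move=> h; apply/negP; rewrite -ltNge].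
  transitivity (\int[P]_w (\1_[set w | (V w < a)%R] w)%:E).
    by apply: eq_integral => w _; rewrite /f !indicE; congr ((nat_of_bool _)%:R)%:E; apply: asbool_equiv_eq; split; rewrite !inE.
  by rewrite integral_indic ?setIT//; exact: measurable_set_lt.
exists (p / 2)%R; first by rewrite divr_gt0.
have := @ae_eventually_sum_le _ _ _ P m V W E G f _ (p / 2)%R mf f01 iF.
rewrite divr_gt0// => /(_ isT); apply: filterS => w [N HN]; exists N => n Nn.
have := HN n Nn.
have -> : (\sum_(i < n) f (W i w) = n%:R - (\sum_(i < n) (a <= W i w)%R)%:R)%R.
  rewrite -[n in n%:R]card_ord -sum1_card natr_sum natr_sum -sumrB.
  apply: eq_bigr => i _; rewrite /f indicE.
  have [h|h] := ltP (W i w) a; first by rewrite mem_set// subr0.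
  by rewrite memNset /= ?subrr//; apply/negP; rewrite -leNgt.
lra.
Qed.

End weight_law.

(** * Upper bound on the maximal in-degree *)

Lemma measurable_forall {d} {T : measurableType d} (D : set nat) (Q : nat -> T -> Prop) :
  (forall i, D i -> measurable [set w | Q i w]) ->
  measurable [set w | forall i, D i -> Q i w].
Proof.
move=> mQ; rewrite (_ : [set w | _] = \bigcap_(i in D) [set w | Q i w]).
  exact: bigcap_measurableType.
by apply/seteqP; split.
Qed.

Section wrg_upper.
Context {d : measure_display} {Omega : measurableType d} {R : realType}.
Variables (P : probability Omega R) (m : nat) (V : {RV P >-> R}).
Variables (W : nat -> {RV P >-> R}) (E : nat -> 'I_m -> {RV P >-> nat}).
Hypothesis G : is_WRG W E V.

Lemma indegreeS n i w : (0 < n)%N ->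
  indegree E n.+1 i w = (indegree E n i w + \sum_k (E n k w == i))%N.
Proof. by move=> n0; rewrite /indegree big_nat_recr. Qed.

Lemma indegree_eq n i w w' :
  (forall j k, (0 < j < n)%N -> E j k w = E j k w') -> indegree E n i w = indegree E n i w'.
Proof.
move=> h; apply: eq_big_nat => j jn; apply: eq_bigr => k _; rewrite h//.
Qed.

Lemma indegree_le n i w : (indegree E n i w <= n * m)%N.
Proof.
apply: (@leq_trans (\sum_(1 <= j < n) m)%N).
  apply: leq_sum => j _; rewrite -[m in leqRHS]card_ord -sum1_card.
  by apply: leq_sum => k _; apply: leq_b1.
by rewrite sum_nat_const_nat leq_mul2r leq_subr orbT.
Qed.

(** Edges point to strictly older vertices. *)
Lemma indegree_new n w : indegree E n.+1 n w = 0%N.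
Proof.
rewrite /indegree big_nat big1// => j /andP[j0 jn]; rewrite big1// => k _.
have := wrg_range G k w j0; case: eqP => // -> ; lia.
Qed.

Lemma measurable_max_indegree n : measurable_fun setT (max_indegree E n).
Proof.
apply: (@measurable_state _ _ _ _ _ W E 0 _ _ n) => w w' [h _].
by apply: eq_bigr => i _; apply: indegree_eq.
Qed.

Lemma measurable_total_weight a b n : (n <= a)%N ->
  measurable_fun [set: wrgT W E a b] (total_weight W n : wrgT W E a b -> R).
Proof.
move=> na; apply: measurable_sum => i; apply: measurable_W.
exact: leq_trans (ltn_ord i) na.
Qed.

Definition weights_ok n := [set w | forall i, [set i | (i < n)%N] i -> 0 <= W i w <= 1].

Lemma measurable_weights_ok n : wrg_sigma W E n n (weights_ok n).
Proof.
apply: (@measurable_forall _ (wrgT W E n n)) => i ni.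
rewrite (_ : [set w | _] = [set w : wrgT W E n n | 0 <= W i w] `&` [set w : wrgT W E n n | W i w <= 1]).
  by apply: measurableI; apply: measurable_set_le => //; apply: measurable_W.
by apply/seteqP; split => w /= => [/andP[]|[-> ->]].
Qed.

Lemma sum_prob n w : total_weight W n w != 0 ->
  \sum_(i < n) W i w / total_weight W n w = 1.
Proof. by move=> h; rewrite -mulr_suml divff. Qed.

Variables (b s : R) (N : nat).

(** The event on which the upper bound is computed.  It depends on the past
    only and decreases with n, so it can be carried through the induction over
    the steps; by the law of large numbers almost every outcome belongs to all
    these events once N is large enough. *)
Definition total_weight_large n := weights_ok n `&`
  [set w | forall j, [set j | (N <= j <= n)%N] j -> b * j%:R <= total_weight W j w].

Lemma measurable_total_weight_large n : wrg_sigma W E n n (total_weight_large n).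
Proof.
apply: (@measurableI _ (wrgT W E n n)); first exact: measurable_weights_ok.
apply: (@measurable_forall _ (wrgT W E n n)) => j /= jn.
by apply: measurable_set_le => //; apply: measurable_total_weight; lia.
Qed.

Lemma total_weight_largeS n : total_weight_large n.+1 `<=` total_weight_large n.
Proof.
move=> w [/= h1 h2]; split => /= [i ni|j]; first by apply: h1; exact: leqW.
by move=> /andP[Nj jn]; apply: h2; rewrite /= Nj leqW.
Qed.

Hypotheses (b0 : 0 < b) (s1 : 1 < s) (N0 : (0 < N)%N).

Let beta : R := m%:R * (s - 1) / b.
Hypothesis beta1 : 1 <= beta.

(** The exponential moment that controls the maximum; s will be theta. *)
Definition sum_pow n w : R := \sum_(i < n) s ^+ indegree E n i w.

Lemma sum_pow_ge0 n w : 0 <= sum_pow n w.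
Proof. by apply: sumr_ge0 => i _; rewrite exprn_ge0// (le_trans _ (ltW s1)). Qed.

Lemma measurable_sum_pow n : measurable_fun setT (sum_pow n).
Proof.
apply: (@measurable_state _ _ _ _ _ W E 0 _ _ n) => w w' [h _].
by apply: eq_bigr => i _; congr (_ ^+ _); apply: indegree_eq.
Qed.

Local Open Scope ereal_scope.

(** A given vertex is hit by each half-edge with probability at most 1 / (b n),
    which multiplies its term by at most
    (1 + (s - 1) / (b n)) ^ m <= exp (beta / n); the final 1 is the new
    vertex. *)
Lemma sum_pow_step n : (N <= n)%N ->
  \int[P]_(w in total_weight_large n.+1) (sum_pow n.+1 w)%:E <=
  (expR (beta / n%:R))%:E * \int[P]_(w in total_weight_large n) (sum_pow n w)%:E + 1.
Proof.
move=> Nn; have n0 : (0 < n)%N by exact: leq_trans Nn.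
have s0 : (0 <= s)%R by rewrite (le_trans _ (ltW s1)).
have mU k : measurable (total_weight_large k) := wrg_sigma_measurable (@measurable_total_weight_large k).
pose K' w : R := (\sum_(i < n) s ^+ indegree E n.+1 i w)%R.
have K'0 w : (0 <= K' w)%R by apply: sumr_ge0 => i _; rewrite exprn_ge0.
have mK' : measurable_fun setT K'.
  apply: (@measurable_state _ _ _ _ _ W E 0 _ _ n.+1) => w w' [h _].
  by apply: eq_bigr => i _; congr (_ ^+ _)%R; apply: indegree_eq.
have sE w : sum_pow n.+1 w = (K' w + 1)%R.
  by rewrite /sum_pow big_ord_recr /= indegree_new expr0.
have step : \int[P]_(w in total_weight_large n) (K' w)%:E <=
    \int[P]_(w in total_weight_large n) (expR (beta / n%:R) * sum_pow n w)%:E.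
  apply: (@wrg_step_le _ _ _ _ _ _ _ _ G 0 n _
    (fun w t => (\sum_(i < n) s ^+ indegree E n i w * s ^+ (\sum_k (t k == i :> nat)))%R)) => //.
  - exact: measurable_total_weight_large.
  - move=> w w' [h _]; congr (_ * _)%R; apply: eq_bigr => i _; congr (_ ^+ _)%R.
    exact: indegree_eq.
  - move=> w w' t [h _]; apply: eq_bigr => i _; congr (_ ^+ _ * _)%R.
    exact: indegree_eq.
  - by move=> w; rewrite mulr_ge0 ?expR_ge0 ?sum_pow_ge0.
  - by move=> w t; apply: sumr_ge0 => i _; rewrite mulr_ge0 ?exprn_ge0.
  - move=> w t ht; apply: eq_bigr => i _; rewrite indegreeS// exprD; congr (_ * _ ^+ _)%R.
    by apply: eq_bigr => k _; rewrite ht.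
  - move=> w i [/= w1 w2]; have /andP[wi0 wi1] := w1 i (ltn_ord i).
    rewrite divr_ge0//; apply: le_trans (w2 n _); last by rewrite /= Nn leqnn.
    by rewrite mulr_ge0// ltW.
  - move=> w [/= w1 w2].
    have Sn : (b * n%:R <= total_weight W n w)%R by apply: w2; rewrite Nn leqnn.
    have bn0 : (0 < b * n%:R)%R by rewrite mulr_gt0// ltr0n.
    have Sn0 : (0 < total_weight W n w)%R by exact: lt_le_trans Sn.
    rewrite /sum_pow mulr_sumr.
    under eq_bigr do rewrite mulr_sumr.
    rewrite exchange_big/=; apply: ler_sum => i _.
    under eq_bigr do rewrite mulrCA.
    rewrite -mulr_sumr [leRHS]mulrC; apply: ler_wpM2l; first exact: exprn_ge0.
    have := @sum_edges_pow _ m n (fun i : 'I_n => W i w / total_weight W n w)%R s i.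
    rewrite sum_prob ?gt_eqF// => /(_ erefl) ->.
    have /andP[wi0 wi1] := w1 i (ltn_ord i).
    have pi1 : (W i w / total_weight W n w <= (b * n%:R)^-1)%R.
      rewrite ler_pdivrMr// mulrC ler_pdivlMr//.
      apply: le_trans Sn; rewrite mulrC -[leRHS]mulr1; apply: ler_wpM2l => //.
      exact: ltW.
    have -> : (beta / n%:R = m%:R * ((s - 1) * (b * n%:R)^-1))%R.
      by rewrite /beta; field; rewrite !gt_eqF// ltr0n.
    rewrite expRM_natl; apply: lerXn2r.
    + by rewrite nnegrE addr_ge0// mulr_ge0 ?subr_ge0 ?(ltW s1)// divr_ge0// ltW.
    + by rewrite nnegrE expR_ge0.
    + apply: (le_trans (expR_ge1Dx _)); rewrite ler_expR; apply: ler_wpM2l => //.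
      by rewrite subr_ge0 ltW.
under eq_integral do rewrite sE EFinD.
rewrite ge0_integralD//; last 2 first.
- by move=> w _; rewrite lee_fin.
- by apply/measurable_EFinP; apply: measurable_funTS.
apply: leeD; last first.
  rewrite integral_cst// mul1e; exact: probability_le1.
apply: (@le_trans _ _ (\int[P]_(w in total_weight_large n) (K' w)%:E)).
  apply: ge0_subset_integral => //; last exact: total_weight_largeS.
  - by apply/measurable_EFinP; apply: measurable_funTS.
  - by move=> w _; rewrite lee_fin.
apply: (le_trans step).
under eq_integral do rewrite EFinM.
rewrite ge0_integralZl//.
- by apply/measurable_EFinP; apply: measurable_funTS; exact: measurable_sum_pow.
- by move=> w _; rewrite lee_fin sum_pow_ge0.
Qed.

(** Solution of the recursion sum_pow_step: the contribution 1 of the vertex born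
    at time n is amplified only afterwards, and exp (- beta harm 1 n.+1) is at
    most 1 / (n + 1) because beta >= 1, so the vertices add up to a harmonic
    sum.  The power of s in front bounds the in-degrees at time N. *)
Lemma integral_sum_pow_le n : (N <= n)%N ->
  \int[P]_(w in total_weight_large n) (sum_pow n w)%:E <=
  (N%:R * s ^+ (N * m) * harm 1 n.+1 * expR (beta * harm 1 n))%:E.
Proof.
have mU k : measurable (total_weight_large k) := wrg_sigma_measurable (@measurable_total_weight_large k).
have s0 : (0 <= s)%R by rewrite (le_trans _ (ltW s1)).
have beta0 : (0 <= beta)%R by rewrite divr_ge0 ?mulr_ge0 ?subr_ge0// ltW.
have C1 : (1 <= N%:R * s ^+ (N * m))%R.
  by rewrite mulr_ege1 ?ler1n// exprn_ege1// ltW.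
have h1 k : (0 < k)%N -> (1 <= @harm R 1 k.+1)%R.
  by move=> k0; rewrite /harm big_ltn// mulr1n invr1 lerDl sumr_ge0.
elim: n => [|n IH]; first by rewrite leqn0 => /eqP N0'; move: N0; rewrite N0'.
rewrite leq_eqVlt => /predU1P[Nn|]; last rewrite ltnS => Nn.
  rewrite -Nn.
  apply: (@le_trans _ _ (\int[P]_(w in total_weight_large N) (N%:R * s ^+ (N * m))%:E)).
    apply: ge0_le_integral => //.
    - by move=> w _; rewrite lee_fin sum_pow_ge0.
    - by apply/measurable_EFinP; apply: measurable_funTS; exact: measurable_sum_pow.
    - move=> w _; rewrite lee_fin /sum_pow.
      have -> : (N%:R * s ^+ (N * m) = \sum_(i < N) s ^+ (N * m))%R.
        by rewrite sumr_const card_ord mulr_natl.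
      apply: ler_sum => i _; apply: ler_weXn2l; first exact: ltW.
      exact: indegree_le.
  rewrite integral_cst//; apply: (@le_trans _ _ (N%:R * s ^+ (N * m))%:E).
    by rewrite -[leRHS]mule1; apply: lee_wpmul2l; [rewrite lee_fin; exact: le_trans C1|exact: probability_le1].
  rewrite lee_fin -mulrA ler_peMr ?(le_trans _ C1)//.
  by rewrite mulr_ege1 ?h1// -expR0 ler_expR mulr_ge0// harm_ge0.
have n0 : (0 < n)%N by exact: leq_trans Nn.
apply: (le_trans (sum_pow_step Nn)).
apply: (@le_trans _ _ ((expR (beta / n%:R))%:E * (N%:R * s ^+ (N * m) * harm 1 n.+1 * expR (beta * harm 1 n))%:E + 1)).
  by apply: leeD => //; apply: lee_wpmul2l; [rewrite lee_fin expR_ge0|exact: IH].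
rewrite -EFinM -EFinD lee_fin.
have -> : (expR (beta / n%:R) * (N%:R * s ^+ (N * m) * harm 1 n.+1 * expR (beta * harm 1 n)) =
   N%:R * s ^+ (N * m) * harm 1 n.+1 * expR (beta * harm 1 n.+1))%R.
  by rewrite (harmS (R := R) n0) [(beta * (_ + _))%R]mulrDr expRD; ring.
rewrite [harm 1 n.+2]harmS// mulrDr mulrDl lerD2l.
have n1 : (0 < n.+1%:R :> R)%R by rewrite ltr0n.
rewrite mulrAC ler_pdivlMr// mul1r.
apply: (le_trans (expR_harm_ge n)).
rewrite -[leLHS]mul1r; apply: ler_pM => //.
by rewrite ler_expR ler_peMl// harm_ge0.
Qed.

Lemma measure_max_indegree_ge_le n k : (N <= n)%N -> (0 < k)%N ->
  P (total_weight_large n `&` [set w | (k <= max_indegree E n w)%N]) <=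
  (s ^- k * (N%:R * s ^+ (N * m) * harm 1 n.+1 * expR (beta * harm 1 n)))%:E.
Proof.
move=> Nn k0.
have mU : measurable (total_weight_large n) := wrg_sigma_measurable (@measurable_total_weight_large n).
have mM : measurable [set w | (k <= max_indegree E n w)%N].
  by have := @measurable_max_indegree n measurableT [set y | (k <= y)%N]; rewrite setTI; apply.
have mUM := measurableI _ _ mU mM.
rewrite EFinM lee_pdivlMl ?exprn_gt0 ?(lt_trans _ s1)//.
apply: le_trans (integral_sum_pow_le Nn).
apply: (@le_trans _ _ (\int[P]_(w in total_weight_large n `&` [set w | (k <= max_indegree E n w)%N]) (sum_pow n w)%:E)).
  apply: measure_le_integral => //.
  - exact: measurable_sum_pow.
  - by rewrite exprn_ge0// (le_trans _ (ltW s1)).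
  - move=> w [_ /= kM].
    have [i ki] : exists i : 'I_n, (k <= indegree E n i w)%N.
      apply: contrapT => ni; move: kM; apply/negP; rewrite -ltnNge -(prednK k0) ltnS.
      apply/bigmax_leqP => i _; rewrite -ltnS prednK// ltnNge; apply/negP => ki.
      by apply: ni; exists i.
    rewrite /sum_pow (bigD1 i)//= -[leLHS]addr0; apply: lerD.
      by apply: ler_weXn2l => //; exact: ltW.
    by apply: sumr_ge0 => j _; rewrite exprn_ge0// (le_trans _ (ltW s1)).
apply: ge0_subset_integral => //.
- by apply/measurable_EFinP; apply: measurable_funTS; exact: measurable_sum_pow.
- by move=> w _; rewrite lee_fin sum_pow_ge0.
Qed.

End wrg_upper.

Section wrg_upper_ae.
Context {d : measure_display} {Omega : measurableType d} {R : realType}.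
Variables (P : probability Omega R) (m : nat) (V : {RV P >-> R}).
Variables (W : nat -> {RV P >-> R}) (E : nat -> 'I_m -> {RV P >-> nat}).
Hypotheses (V_ge0 : forall w, 0 <= V w) (V_endpoint : upper_endpoint V = 1%E).
Hypothesis G : is_WRG W E V.
Hypothesis m_gt0 : (0 < m)%N.

Lemma theta_gt1 : 1 < theta m V.
Proof. by rewrite /theta ltrDl divr_gt0 ?ltr0n// mu_gt0. Qed.

(** The bound of measure_max_indegree_ge_le at n = grid c k, with s = theta, is a
    polynomial in k times exp (k (beta / c - log theta)), where
    beta = mu / b. *)
Lemma ae_max_indegree_lt (c : R) : 0 < c -> 1 < c * ln (theta m V) ->
  {ae P, forall w, exists K, forall k, (K <= k)%N -> (max_indegree E (grid c k) w < k)%N}.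
Proof.
move=> c0; set th := theta m V => cth.
have th1 : 1 < th := theta_gt1.
set mu := fine 'E_P[V]; have mu0 : 0 < mu := mu_gt0 V_ge0 V_endpoint.
pose q := c * ln th.
(* Chosen so that beta = mu / b = (1 + q) / 2 lies strictly between 1 and
   q = c log theta. *)
pose b := mu * 2 / (1 + q).
have q1 : 1 < q by [].
have b0 : 0 < b by rewrite divr_gt0 ?mulr_gt0//; lra.
have bmu : b < mu by rewrite ltr_pdivrMr ?ltr_pM2l//; lra.
have m0 : 0 < m%:R :> R by rewrite ltr0n.
have betaE : m%:R * (th - 1) / b = (1 + q) / 2.
  rewrite /th /theta -/mu /b; field.
  by rewrite !gt_eqF//; lra.
have beta1 : 1 <= m%:R * (th - 1) / b by rewrite betaE; lra.
pose dlt := (q - 1) / (2 * c).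
have dlt0 : 0 < dlt by rewrite divr_gt0 ?mulr_gt0// subr_gt0.
pose B N k := total_weight_large W b N.+1 (grid c k) `&` [set w | (k <= max_indegree E (grid c k) w)%N].
have mB N k : measurable (B N k).
  apply: measurableI; first exact: wrg_sigma_measurable (@measurable_total_weight_large _ _ _ _ m W E b N.+1 (grid c k)).
  by have := @measurable_max_indegree _ _ _ P m W E (grid c k) measurableT [set y | (k <= y)%N]; rewrite setTI; apply.
have HB N : {ae P, forall w, exists K', forall k, (K' <= k)%N -> ~ B N k w}.
  have [K1 HK1] := grid_ge N.+1 c0.
  pose C0 : R := N.+1%:R * th ^+ (N.+1 * m) * expR ((1 + q) / 2).
  have C00 : 0 <= C0 by rewrite !mulr_ge0 ?expR_ge0// exprn_ge0// ltW// (lt_trans _ th1).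
  apply: (@ae_eventually_not _ _ _ P (B N) (C0 * (2 + 2 * c^-1 / dlt)) (expR (- (dlt / 2))) (maxn K1 1)) => //.
  - apply: mulr_ge0 => //; apply: addr_ge0 => //; apply: divr_ge0; last exact: ltW.
    by apply: mulr_ge0 => //; rewrite invr_ge0 ltW.
  - by rewrite -[ltRHS]expR0 ltr_expR oppr_lt0 divr_gt0.
  move=> k; rewrite geq_max => /andP[Kk k0].
  have h := measure_max_indegree_ge_le G b0 th1 (ltn0Sn N) beta1 (HK1 k Kk) k0.
  apply: (le_trans h).
  rewrite lee_fin betaE.
  have H1 := harm_grid_le k c0.
  have H2 : harm 1 (grid c k).+1 <= 2 + c^-1 * k%:R.
    rewrite harmS ?grid_gt0//.
    have : (grid c k)%:R^-1 <= 1 :> R by rewrite invf_le1 ?ltr0n ?ler1n grid_gt0.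
    rewrite [c^-1 * _]mulrC; lra.
  have th0 : 0 < th by exact: lt_trans th1.
  have -> : th ^- k = expR (- ln th * k%:R).
    by rewrite expRM_natr expRN lnK ?posrE// exprVn.
  apply: (@le_trans _ _ (C0 * ((2 + c^-1 * k%:R) * expR (- dlt * k%:R)))); last first.
    by rewrite -mulrA; apply: ler_wpM2l => //; apply: poly_expR_le; rewrite ?invr_ge0 ?ltW.
  have E1 : expR (- dlt * k%:R) = expR (- ln th * k%:R) * expR ((1 + q) / 2 * (k%:R / c)).
    rewrite -expRD; congr expR; rewrite /dlt /q; field; by rewrite gt_eqF.
  have E2 : expR ((1 + q) / 2 * harm 1 (grid c k)) <= expR ((1 + q) / 2) * expR ((1 + q) / 2 * (k%:R / c)).
    rewrite -expRD ler_expR.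
    have -> : (1 + q) / 2 + (1 + q) / 2 * (k%:R / c) = (1 + q) / 2 * (1 + k%:R / c) by ring.
    by apply: ler_wpM2l => //; lra.
  rewrite E1 /C0.
  have -> : N.+1%:R * th ^+ (N.+1 * m) * expR ((1 + q) / 2) * ((2 + c^-1 * k%:R) * (expR (- ln th * k%:R) * expR ((1 + q) / 2 * (k%:R / c))))
    = expR (- ln th * k%:R) * (N.+1%:R * th ^+ (N.+1 * m) * (2 + c^-1 * k%:R) * (expR ((1 + q) / 2) * expR ((1 + q) / 2 * (k%:R / c)))) by ring.
  apply: ler_wpM2l; first exact: expR_ge0.
  have Np : 0 <= N.+1%:R * th ^+ (N.+1 * m) by rewrite mulr_ge0// exprn_ge0// ltW.
  apply: ler_pM => //; rewrite ?expR_ge0//.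
  - by rewrite mulr_ge0// harm_ge0.
  - exact: ler_wpM2l.
have HS := ae_total_weight_ge V_ge0 V_endpoint G bmu.
have HW := ae_weights V_ge0 V_endpoint G.
apply: filterS3 HW HS (ae_foralln HB) => w ok [N HN] HBw.
have [K HK] := HBw N; exists K => k Kk.
rewrite ltnNge; apply/negP => kM; apply: (HK k Kk); split => //; split => [i _|j /= /andP[Nj _]]; first exact: ok.
by apply: HN; exact: ltnW.
Qed.

End wrg_upper_ae.

(** * Lower bound on the maximal in-degree *)

Section wrg_lower.
Context {d : measure_display} {Omega : measurableType d} {R : realType}.
Variables (P : probability Omega R) (m : nat) (V : {RV P >-> R}).
Variables (W : nat -> {RV P >-> R}) (E : nat -> 'I_m -> {RV P >-> nat}).
Hypothesis G : is_WRG W E V.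
Variables (a b rho : R) (k n0 n : nat).

(** The candidates for a large in-degree: early vertices of weight at least a. *)
Definition heavy w : seq nat := [seq i <- index_iota 0 n0 | a <= W i w].

Lemma size_heavy w : size (heavy w) = (\sum_(i < n0) (a <= W i w)%R)%N.
Proof.
by rewrite -sum1_size big_filter big_mkcond big_mkord; apply: eq_bigr => i _; case: ifP.
Qed.

Lemma heavy_same j w w' : (n0 <= j)%N -> same_state W E a j w w' -> heavy w = heavy w'.
Proof.
move=> nj [_ h]; apply: eq_in_filter => i; rewrite mem_index_iota => /andP[_ ni].
by apply: h; exact: leq_trans nj.
Qed.

(** The event on which the lower bound is computed: from time n0 on the total
    weight is at most b l, and there are many heavy vertices.  It depends on
    the past only and decreases with j. *)
Definition total_weight_small j := weights_ok W j `&`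
  [set w | forall l, [set l | (n0 <= l <= j)%N] l -> 0 < total_weight W l w <= b * l%:R] `&`
  [set w | rho * n0%:R <= (size (heavy w))%:R].

Lemma measurable_total_weight_small j : (n0 <= j)%N -> wrg_sigma W E j j (total_weight_small j).
Proof.
move=> nj; apply: (@measurableI _ (wrgT W E j j)); last first.
  by apply: wrg_sigma_state => w w' /(heavy_same nj) /= ->.
apply: (@measurableI _ (wrgT W E j j)); first exact: measurable_weights_ok.
apply: (@measurable_forall _ (wrgT W E j j)) => l /= /andP[_ lj].
rewrite (_ : [set w | _] = [set w : wrgT W E j j | 0 < total_weight W l w] `&`
   [set w : wrgT W E j j | total_weight W l w <= b * l%:R]).
  apply: measurableI; first by apply: measurable_set_lt => //; apply: measurable_total_weight.
  by apply: measurable_set_le => //; apply: measurable_total_weight.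
by apply/seteqP; split => w /= => [/andP[]|[-> ->]].
Qed.

Lemma total_weight_smallS j : total_weight_small j.+1 `<=` total_weight_small j.
Proof.
move=> w [[/= h1 h2] h3]; split => //; split => /= [i ni|l /andP[nl lj]].
  by apply: h1 => /=; exact: leqW.
by apply: h2; rewrite /= nl leqW.
Qed.

Hypotheses (a0 : 0 < a) (b0 : 0 < b) (n0_gt0 : (0 < n0)%N).

(** Probability that, in the comparison chain, a vertex with in-degree z at time
    j is still below k at time n. *)
Definition miss j (z : nat) : R := 1 - success_tail (odds m (a / b) j n) (k - z).

Lemma odds_ge0 j : (0 < j)%N -> all (>= 0) (odds m (a / b) j n).
Proof.
move=> j0; have kap0 : 0 <= a / b by rewrite divr_ge0// ltW.
by apply: sub_all (@odds_le R m (a / b) j n kap0 j0) => x /andP[].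
Qed.

Lemma miss_itv j z : (0 < j)%N -> 0 <= miss j z <= 1.
Proof.
move=> j0; have /andP[h0 h1] := success_tail_itv (k - z) (odds_ge0 j0).
by rewrite /miss subr_ge0 h1 gerBl.
Qed.

Lemma miss_noninc j z : (0 < j)%N -> miss j z.+1 <= miss j z.
Proof.
move=> j0; rewrite /miss lerD2l lerN2 subnS.
by case: (k - z)%N => // r; exact: success_tail_noninc (odds_ge0 j0).
Qed.

Definition all_miss j w : R := \prod_(l <- heavy w) miss j (indegree E j l w).

Lemma all_miss_ge0 j w : (0 < j)%N -> 0 <= all_miss j w.
Proof. by move=> j0; apply: prodr_ge0 => l _; have /andP[] := miss_itv (indegree E j l w) j0. Qed.

Lemma measurable_all_miss j : (n0 <= j)%N -> measurable_fun setT (all_miss j).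
Proof.
move=> nj; apply: (@measurable_state _ _ _ _ _ W E a _ _ j) => w w' sw.
rewrite /all_miss (heavy_same nj sw); apply: eq_bigr => l _; congr miss.
by apply: indegree_eq; case: sw.
Qed.

Local Open Scope ereal_scope.

(** The supermartingale property: a heavy vertex is hit by each half-edge with
    probability at least a / (b j), so edges_le compares the m half-edges of
    vertex j with m steps of the comparison chain, for which miss is
    harmonic. *)
Lemma all_miss_step j : (n0 <= j < n)%N ->
  \int[P]_(w in total_weight_small j.+1) (all_miss j.+1 w)%:E <=
  \int[P]_(w in total_weight_small j) (all_miss j w)%:E.
Proof.
move=> /andP[nj jn].
have j0 : (0 < j)%N by exact: leq_trans nj.
have mL i : (n0 <= i)%N -> measurable (total_weight_small i).
  by move=> ni; exact: wrg_sigma_measurable (@measurable_total_weight_small i ni).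
have mE i D : (n0 <= i)%N -> measurable_fun D (fun w => (all_miss i w)%:E).
  by move=> ni; apply/measurable_EFinP; apply: measurable_funTS; exact: measurable_all_miss.
apply: (@le_trans _ _ (\int[P]_(w in total_weight_small j) (all_miss j.+1 w)%:E)).
  apply: ge0_subset_integral => //; last exact: total_weight_smallS.
  - by apply: mL; exact: leqW.
  - exact: mL.
  - by apply: mE; exact: leqW.
  - by move=> w _; rewrite lee_fin all_miss_ge0.
apply: (@wrg_step_le _ _ _ _ _ _ _ _ G a j _ (fun w t =>
   \prod_(l <- heavy w) miss j.+1 (indegree E j l w + \sum_k (t k == l :> nat)))%R) => //.
- exact: measurable_total_weight_small.
- move=> w w' sw; rewrite /all_miss (heavy_same nj sw); apply: eq_bigr => l _; congr miss.
  by apply: indegree_eq; case: sw.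
- move=> w w' t sw; rewrite (heavy_same nj sw); apply: eq_bigr => l _; congr (miss _ (_ + _)%N).
  by apply: indegree_eq; case: sw.
- by apply: measurable_all_miss; exact: leqW.
- by move=> w; exact: all_miss_ge0.
- by move=> w t; apply: prodr_ge0 => l _; have /andP[] := @miss_itv j.+1 (indegree E j l w + \sum_k0 (t k0 == l :> nat)) (ltn0Sn j).
- move=> w t ht; apply: eq_bigr => l _; rewrite indegreeS//; congr (miss _ (_ + _)%N).
  by apply: eq_bigr => i _; rewrite ht.
- move=> w i [[/= w1 w2] _]; have /andP[wi0 _] := w1 i (ltn_ord i).
  have /andP[/ltW S0 _] : (0 < total_weight W j w <= b * j%:R)%R by apply: w2; rewrite /= nj leqnn.
  exact: divr_ge0.
move=> w [[/= w1 w2] _].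
have /andP[S0 Sb] : (0 < total_weight W j w <= b * j%:R)%R by apply: w2; rewrite /= nj leqnn.
pose aj : R := (a / b / j%:R)%R.
have jR : (0 < j%:R :> R)%R by rewrite ltr0n.
have aj0 : (0 < aj)%R by rewrite !divr_gt0.
have q0 : (0 <= aj / (1 + aj))%R by rewrite divr_ge0// ltW//; lra.
have q1 : (aj / (1 + aj) <= 1)%R by rewrite ler_pdivrMr; lra.
have qaj : (aj / (1 + aj) <= aj)%R by rewrite ler_pdivrMr; nra.
have -> : all_miss j w = (\prod_(l <- heavy w) iter m (mix (aj / (1 + aj))) (miss j.+1) (indegree E j l w))%R.
  apply: eq_bigr => l _; rewrite /miss oddsS// -iter_mix_success_tail//; exact: ltW.
apply: (@edges_le R m j (fun i : 'I_j => W i w / total_weight W j w)%R (aj / (1 + aj))%R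
  (heavy w) (fun l => indegree E j l w) (miss j.+1)) => //.
- by move=> z; have /andP[] := @miss_itv j.+1 z (ltn0Sn j).
- by move=> z; exact: miss_noninc.
- by move=> i; have /andP[wi0 _] := w1 i (ltn_ord i); apply: divr_ge0 => //; exact: ltW.
- by rewrite sum_prob// gt_eqF.
- by apply: filter_uniq; exact: iota_uniq.
- move=> l; rewrite mem_filter mem_index_iota => /andP[aW /andP[_ ln]].
  have lj : (l < j)%N by exact: leq_trans nj.
  exists (Ordinal lj) => //=; apply: (le_trans qaj).
  rewrite ler_pdivlMr//; apply: le_trans aW.
  have -> : a = (aj * (b * j%:R))%R by rewrite /aj; field; rewrite !gt_eqF.
  by apply: ler_wpM2l => //; exact: ltW.
Qed.

Lemma all_miss_le : (n0 <= n)%N ->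
  \int[P]_(w in total_weight_small n) (all_miss n w)%:E <=
  \int[P]_(w in total_weight_small n0) (all_miss n0 w)%:E.
Proof.
move=> n0n.
have H j : (n0 <= j)%N -> (j <= n)%N -> \int[P]_(w in total_weight_small j) (all_miss j w)%:E <=
  \int[P]_(w in total_weight_small n0) (all_miss n0 w)%:E.
  elim: j => [|j IH]; first by rewrite leqn0 => /eqP ->.
  rewrite leq_eqVlt => /predU1P[<-//|]; rewrite ltnS => nj jn.
  by apply: (le_trans (@all_miss_step j _)); [rewrite nj | apply: IH => //; exact: ltnW].
exact: H.
Qed.

(** At time n the product all_miss is 1 if no heavy vertex has reached k, and at
    time n0 it is at most (1 - g) ^ (rho n0) with g the success probability
    from degree 0. *)
Lemma measure_max_indegree_lt_le : (n0 <= n)%N -> (0 <= rho)%R ->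
  P (total_weight_small n `&` [set w | (max_indegree E n w < k)%N]) <=
  (expR (- (rho * n0%:R * success_tail (odds m (a / b) n0 n) k)))%:E.
Proof.
move=> n0n rho0; have n_gt0 : (0 < n)%N by exact: leq_trans n0n.
have mL i : (n0 <= i)%N -> measurable (total_weight_small i).
  by move=> ni; exact: wrg_sigma_measurable (@measurable_total_weight_small i ni).
have mE i D : (n0 <= i)%N -> measurable_fun D (fun w => (all_miss i w)%:E).
  by move=> ni; apply/measurable_EFinP; apply: measurable_funTS; exact: measurable_all_miss.
have mM : measurable [set w | (max_indegree E n w < k)%N].
  by have := @measurable_max_indegree _ _ _ P m W E n measurableT [set y | (y < k)%N]; rewrite setTI; apply.
set g := success_tail _ k.
have /andP[g0 g1] : (0 <= g <= 1)%R by exact: success_tail_itv (odds_ge0 n0_gt0).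
apply: (@le_trans _ _ (\int[P]_(w in total_weight_small n) (all_miss n w)%:E)).
  apply: (@le_trans _ _ (\int[P]_(w in total_weight_small n `&` [set w | (max_indegree E n w < k)%N]) (all_miss n w)%:E)).
    rewrite -[leLHS]mul1e; apply: measure_le_integral => //.
    - by apply: measurableI => //; exact: mL.
    - exact: measurable_all_miss.
    - move=> w [_ /= Mk]; rewrite /all_miss big_seq big1// => l.
      rewrite mem_filter mem_index_iota => /andP[_ /andP[_ ln]].
      have ln' : (l < n)%N by exact: leq_trans n0n.
      have lk : (indegree E n l w < k)%N.
        apply: leq_ltn_trans Mk.
        exact: (leq_bigmax (F := fun i : 'I_n => indegree E n i w) (Ordinal ln')).
      rewrite /miss odds_nil /= subn_eq0 leqNgt lk subr0//.
  apply: ge0_subset_integral => //.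
  - by apply: measurableI => //; exact: mL.
  - exact: mL.
  - exact: mE.
  - by move=> w _; rewrite lee_fin all_miss_ge0.
apply: (le_trans (all_miss_le n0n)).
apply: (@le_trans _ _ (\int[P]_(w in total_weight_small n0) (expR (- (rho * n0%:R * g)))%:E)).
  apply: ge0_le_integral => //.
  - exact: mL.
  - by move=> w _; rewrite lee_fin all_miss_ge0.
  - exact: mE.
  - move=> w [_ /= hw]; rewrite lee_fin.
    apply: (@le_trans _ _ (\prod_(l <- heavy w) expR (- g))%R).
      apply: ler_prod => l _; have /andP[-> _] /= := miss_itv (indegree E n0 l w) n0_gt0.
      apply: (@le_trans _ _ (1 - g)%R); last exact: expR_ge1Dx.
      rewrite lerD2l lerN2; elim: (indegree E n0 l w) => [|z IH]; first by rewrite subn0.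
      apply: (le_trans IH); rewrite subnS.
      by case: (k - z)%N => // r; exact: success_tail_noninc (odds_ge0 n0_gt0).
    rewrite -expR_sum ler_expR big_const_seq count_predT iter_addr_0 mulNrn lerN2.
    by rewrite -[(g *+ _)%R]mulr_natl; apply: ler_wpM2r.
rewrite integral_cst//; last exact: mL.
rewrite -[leRHS]mule1; apply: lee_wpmul2l; first by rewrite lee_fin expR_ge0.
by apply: probability_le1; exact: mL.
Qed.

End wrg_lower.

Section wrg_lower_ae.
Context {d : measure_display} {Omega : measurableType d} {R : realType}.
Variables (P : probability Omega R) (m : nat) (V : {RV P >-> R}).
Variables (W : nat -> {RV P >-> R}) (E : nat -> 'I_m -> {RV P >-> nat}).
Hypotheses (V_ge0 : forall w, 0 <= V w) (V_endpoint : upper_endpoint V = 1%E).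
Hypothesis G : is_WRG W E V.
Hypothesis m_gt0 : (0 < m)%N.

(** Since c log theta < 1 there is a value mu' > mu that still satisfies
    c log (1 + mu' / m) < 1.  A weight threshold a < 1 and a bound b > mu on
    the total weight per vertex with a / b = 1 / mu' then satisfy the
    hypotheses of success_tail_odds_ge. *)
Lemma ae_max_indegree_ge (c : R) : 0 < c -> c * ln (theta m V) < 1 ->
  {ae P, forall w, exists K, forall k, (K <= k)%N -> (k <= max_indegree E (grid c k) w)%N}.
Proof.
move=> c0 cth.
set mu := fine 'E_P[V]; have mu0 : 0 < mu := mu_gt0 V_ge0 V_endpoint.
have th1 := theta_gt1 V_ge0 V_endpoint m_gt0.
have m0 : 0 < m%:R :> R by rewrite ltr0n.
have the : theta m V < expR c^-1.
  rewrite -[ltLHS]lnK ?posrE ?(lt_trans _ th1)// ltr_expR.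
  by rewrite -[c^-1]mul1r ltr_pdivlMr// mulrC.
(* the value of mu' at which c log (1 + mu' / m) would be 1 *)
pose y := (expR c^-1 - 1) * m%:R.
have muy : mu < y by rewrite /y -ltr_pdivrMr//; move: the; rewrite /theta -/mu; lra.
pose mu' := (mu + y) / 2.
have mumu' : mu < mu' by rewrite /mu'; lra.
have mu'y : mu' < y by rewrite /mu'; lra.
have mu'0 : 0 < mu' by exact: lt_trans mumu'.
pose a := (1 + mu / mu') / 2.
have r0 : 0 < mu / mu' by rewrite divr_gt0.
have r1 : mu / mu' < 1 by rewrite ltr_pdivrMr// mul1r.
have a0 : 0 < a by rewrite /a; lra.
have a1 : a < 1 by rewrite /a; lra.
pose b := a * mu'.
have bE : b = (mu' + mu) / 2 by rewrite /b /a; field; rewrite gt_eqF.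
have b0 : 0 < b by rewrite mulr_gt0.
have mub : mu < b by rewrite bE; lra.
have kapE : a / b = mu'^-1 by rewrite /b; field; rewrite !gt_eqF.
have kap0 : 0 < a / b by rewrite divr_gt0.
have cL : c * ln (1 + (m%:R * (a / b))^-1) < 1.
  rewrite mulrC -ltr_pdivlMr// div1r -[ltRHS]expRK ltr_ln ?posrE ?expR_gt0//; last first.
    by rewrite addr_gt0// invr_gt0 mulr_gt0.
  rewrite kapE invfM invrK.
  have : mu' / m%:R < expR c^-1 - 1 by rewrite ltr_pdivrMr.
  rewrite mulrC; lra.
have [gam [C [dlt [gam0 gam1 C0 dlt0 [K1 HK1]]]]] := success_tail_odds_ge kap0 m_gt0 c0 cL.
have [rho rho0 Hrho] := ae_heavy_ge V_endpoint G a1.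
have cg0 : 0 < c / gam by rewrite divr_gt0.
pose n0 k := grid (c / gam) k; pose n k := grid c k.
have n0_gt0 k : (0 < n0 k)%N by exact: grid_gt0.
have n0n k : (n0 k <= n k)%N.
  apply: le_truncn; rewrite ler_expR ler_wpM2l// invf_div ler_pdivrMr// mulVf ?gt_eqF//.
  exact: ltW.
pose B k := total_weight_small W a b rho (n0 k) (n k) `&` [set w | (max_indegree E (n k) w < k)%N].
have mB k : measurable (B k).
  apply: measurableI; first exact: wrg_sigma_measurable (@measurable_total_weight_small _ _ _ P m W E a b rho (n0 k) (n k) (n0n k)).
  by have := @measurable_max_indegree _ _ _ P m W E (n k) measurableT [set y | (y < k)%N]; rewrite setTI; apply.
have HB : {ae P, forall w, exists K', forall k, (K' <= k)%N -> ~ B k w}.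
  apply: (@ae_eventually_not _ _ _ P B (rho * C)^-1 (expR (- dlt)) K1 mB) => //.
  - by rewrite invr_ge0 mulr_ge0// ltW.
  - by rewrite -[ltRHS]expR0 ltr_expR oppr_lt0.
  move=> k Kk; have h := measure_max_indegree_lt_le G k a0 b0 (n0_gt0 k) (n0n k) (ltW rho0).
  apply: (le_trans h); rewrite lee_fin.
  have := HK1 k Kk; rewrite -/(n0 k) -/(n k); set g := success_tail _ k => Hg.
  have x0 : 0 < rho * C * expR (dlt * k%:R) by rewrite !mulr_gt0// expR_gt0.
  have xg : rho * C * expR (dlt * k%:R) <= rho * (n0 k)%:R * g.
    by rewrite -!mulrA; apply: ler_wpM2l => //; exact: ltW.
  rewrite -expRM_natr mulNr !expRN -invfM lef_pV2 ?posrE ?expR_gt0//.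
  apply: (le_trans xg); apply: (le_trans _ (expR_ge1Dx _)).
  by rewrite lerDr.
have HU := ae_total_weight_le V_ge0 V_endpoint G mub.
have hmu2 : mu / 2 < mu by lra.
have HD := ae_total_weight_ge V_ge0 V_endpoint G hmu2.
have HW := ae_weights V_ge0 V_endpoint G.
have HUD : {ae P, forall w, exists N, forall n, (N <= n)%N ->
    mu / 2 * n%:R <= total_weight W n w /\ total_weight W n w <= b * n%:R}.
  apply: filterS2 HU HD => w [N1 H1] [N2 H2]; exists (maxn N1 N2) => l.
  by rewrite geq_max => /andP[l1 l2]; split; [exact: H2|exact: H1].
have HWr : {ae P, forall w, (forall i, 0 <= W i w <= 1) /\ exists N, forall n, (N <= n)%N ->
    rho * n%:R <= (\sum_(i < n) (a <= W i w)%R)%:R}.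
  by apply: filterS2 HW Hrho => w h1 h2; split.
apply: filterS3 HWr HUD HB => w [ok [N1 H1]] [N2 H2] [K2 H3].
have [K3 HK3] := grid_ge (maxn N1 N2) cg0.
exists (maxn K2 K3) => k; rewrite geq_max => /andP[k2 k3].
have := HK3 k k3; rewrite geq_max => /andP[n1 n2].
rewrite leqNgt; apply/negP => Mk; apply: (H3 k k2); split => //; split; last first.
  by rewrite /= size_heavy; exact: H1.
split; first by move=> i _; exact: ok.
move=> l /= /andP[nl _].
have [h1 h2] := H2 l (leq_trans n2 nl).
rewrite h2 andbT; apply: lt_le_trans h1.
by rewrite mulr_gt0 ?divr_gt0// ltr0n; exact: leq_trans nl.
Qed.

Lemma max_indegree_nondecreasing w n n' : (n <= n')%N ->
  (max_indegree E n w <= max_indegree E n' w)%N.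
Proof.
move=> nn; apply/bigmax_leqP => i _.
apply: (@leq_trans (indegree E n' i w)).
  have n0 : (0 < n)%N by exact: leq_ltn_trans (ltn_ord i).
  by rewrite /indegree [in leqRHS](big_cat_nat _ (n := n))//= leq_addr.
exact: (leq_bigmax (F := fun i : 'I_n' => indegree E n' i w) (widen_ord nn i)).
Qed.

End wrg_lower_ae.

(** * From the grid to all times *)

Section grid_limit.
Context {R : realType}.
Variable M : nat -> nat.
Hypothesis M_nd : forall n n', (n <= n')%N -> (M n <= M n')%N.

Lemma ln_ge_eventually (T : R) : exists N, forall n, (N <= n)%N -> T <= ln n%:R.
Proof.
exists (Num.truncn (expR T)).+1 => n Nn.
have h : expR T <= n%:R by rewrite ltW// (lt_le_trans (truncnS_gt _))// ler_nat.
by rewrite -[leLHS]expRK ler_ln ?posrE ?expR_gt0// (lt_le_trans (expR_gt0 T)).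
Qed.

(** For n given, the first index k above c log n is used: an in-degree smaller
    than k is at most k - 1 <= c log n. *)
Lemma grid_upper (c : R) : 0 < c ->
  (exists K, forall k, (K <= k)%N -> (M (grid c k) < k)%N) ->
  exists N, forall n, (N <= n)%N -> (M n)%:R <= c * ln n%:R.
Proof.
move=> c0 [K HK]; have [N HN] := ln_ge_eventually (K%:R / c).
exists N.+1 => n Nn; have n0 : (0 < n)%N by exact: leq_trans Nn.
have lnn := HN n (ltnW Nn).
have cl : K%:R <= c * ln n%:R by rewrite mulrC -ler_pdivrMr.
have cl0 : 0 <= c * ln n%:R by rewrite (le_trans _ cl).
pose k := (Num.truncn (c * ln n%:R)).+1.
have Kk : (K <= k)%N by rewrite leqW// truncn_ge_nat.
have nk : (n <= grid c k)%N.
  rewrite /grid truncn_ge_nat ?expR_ge0// -[leLHS]lnK ?posrE ?ltr0n// ler_expR.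
  by rewrite ler_pdivlMr// mulrC ltW// truncnS_gt.
have := leq_ltn_trans (M_nd nk) (HK k Kk); rewrite ltnS => h.
by apply: (@le_trans _ _ (Num.truncn (c * ln n%:R))%:R); rewrite ?ler_nat// truncn_le.
Qed.

(** For n given, the last grid index below c log n is used. *)
Lemma grid_lower (c : R) : 0 < c ->
  (exists K, forall k, (K <= k)%N -> (k <= M (grid c k))%N) ->
  exists N, forall n, (N <= n)%N -> c * ln n%:R - 1 <= (M n)%:R.
Proof.
move=> c0 [K HK]; have [N HN] := ln_ge_eventually (K%:R / c).
exists N.+1 => n Nn; have n0 : (0 < n)%N by exact: leq_trans Nn.
have lnn := HN n (ltnW Nn).
have cl : K%:R <= c * ln n%:R by rewrite mulrC -ler_pdivrMr.
have cl0 : 0 <= c * ln n%:R by rewrite (le_trans _ cl).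
pose k := Num.truncn (c * ln n%:R).
have Kk : (K <= k)%N by rewrite truncn_ge_nat.
have nk : (grid c k <= n)%N.
  rewrite -(ler_nat R); apply: (le_trans (grid_le _ _)).
  rewrite -[leRHS]lnK ?posrE ?ltr0n// ler_expR ler_pdivrMr// mulrC truncn_le//.
have := leq_trans (HK k Kk) (M_nd nk); rewrite -(ler_nat R) => h.
by apply: le_trans h; rewrite lerBlDr natr1 ltW// truncnS_gt.
Qed.

(** The two sequences of constants decrease, respectively increase, to l; being
    countable, they allow the exceptional null sets to be united. *)
Lemma cvg_ratio_ln (l : R) : 0 < l ->
  (forall j, exists K, forall k, (K <= k)%N -> (M (grid (l + j.+1%:R^-1) k) < k)%N) ->
  (forall j, exists K, forall k, (K <= k)%N -> (k <= M (grid (l - l / j.+2%:R) k))%N) ->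
  ((M n)%:R / ln n%:R) @[n --> \oo] --> l.
Proof.
move=> l0 Hu Hl; apply/cvgrPdist_le => e e0.
have e20 : 0 < e / 2 by rewrite divr_gt0.
pose j := Num.truncn ((1 + l) / (e / 2)).
have je : (1 + l) / (e / 2) < j.+1%:R by exact: truncnS_gt.
have jp : 0 < j.+1%:R :> R by rewrite ltr0n.
have je' : (1 + l) / j.+1%:R < e / 2.
  by rewrite ltr_pdivrMr// mulrC -ltr_pdivrMr.
have j1 : j.+1%:R^-1 <= e / 2.
  apply: le_trans (ltW je'); rewrite -[leLHS]mul1r; apply: ler_wpM2r; last by lra.
  by rewrite invr_ge0 ltW.
have j2 : l / j.+2%:R <= e / 2.
  apply: le_trans (ltW je'); apply: ler_pM => //; [exact: ltW|lra|].
  by rewrite lef_pV2 ?posrE ?ltr0n// ler_nat.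
have lj0 : 0 < l - l / j.+2%:R.
  by rewrite subr_gt0 ltr_pdivrMr ?ltr0n// ltr_pMr// ltr1n.
have lj1 : 0 < l + j.+1%:R^-1 by rewrite addr_gt0// invr_gt0.
have [N1 H1] := grid_upper lj1 (Hu j).
have [N2 H2] := grid_lower lj0 (Hl j).
have [N3 H3] := ln_ge_eventually (2 / e).
exists (maxn N1 (maxn N2 N3)) => // n /=; rewrite !geq_max => /and3P[n1 n2 n3].
have lnn := H3 n n3; have ln0 : 0 < ln n%:R :> R by apply: lt_le_trans lnn; rewrite divr_gt0.
have h1 := H1 n n1; have h2 := H2 n n2.
have e1 : 1 <= e / 2 * ln n%:R by rewrite -ler_pdivrMl// mulr1 invf_div.
rewrite ler_distlC; apply/andP; split.
  rewrite ler_pdivlMr//; apply: le_trans h2.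
  have : l / j.+2%:R * ln n%:R <= e / 2 * ln n%:R by apply: ler_wpM2r => //; exact: ltW.
  rewrite !mulrBl; move: (l / j.+2%:R * ln n%:R) => u hu.
  have -> : e * ln n%:R = e / 2 * ln n%:R + e / 2 * ln n%:R by field.
  lra.
rewrite ler_pdivrMr//; apply: (le_trans h1); apply: ler_wpM2r; first exact: ltW.
by rewrite lerD2l (le_trans j1)//; lra.
Qed.

End grid_limit.

Theorem theorem2p9 (d : measure_display) (Omega : measurableType d)
    (R : realType) (P : probability Omega R) (m : nat) (V : {RV P >-> R})
    (W : nat -> {RV P >-> R}) (E : nat -> 'I_m -> {RV P >-> nat})
    (m_gt0 : (0 < m)%N)
    (V_ge0 : forall w, 0 <= V w)
    (V_gt0 : P [set w | 0 < V w] = 1%E)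
    (V_bounded : exists M : R, {ae P, forall w, V w <= M})
    (V_endpoint : upper_endpoint V = 1%E)
    (G : is_WRG W E V) :
  {ae P, forall w,
    ((max_indegree E n w)%:R / ln (n%:R : R)) @[n --> \oo]
      --> (ln (theta m V))^-1}.
Proof.
have L0 : 0 < ln (theta m V) by rewrite ln_gt0// theta_gt1.
set l := (ln (theta m V))^-1; have l0 : 0 < l by rewrite invr_gt0.
have HU : {ae P, forall w, forall j, exists K, forall k, (K <= k)%N ->
    (max_indegree E (grid (l + j.+1%:R^-1) k) w < k)%N}.
  apply: ae_foralln => j; apply: (ae_max_indegree_lt V_ge0 V_endpoint G m_gt0).
    by rewrite addr_gt0// invr_gt0.
  by rewrite mulrDl /l mulVf ?gt_eqF// ltrDl mulr_gt0// invr_gt0.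
have HL : {ae P, forall w, forall j, exists K, forall k, (K <= k)%N ->
    (k <= max_indegree E (grid (l - l / j.+2%:R) k) w)%N}.
  apply: ae_foralln => j; apply: (ae_max_indegree_ge V_ge0 V_endpoint G m_gt0).
    by rewrite subr_gt0 ltr_pdivrMr ?ltr0n// ltr_pMr// ltr1n.
  rewrite mulrBl /l mulVf ?gt_eqF// ltrBlDr ltrDl.
  by rewrite mulr_gt0// divr_gt0// invr_gt0.
apply: filterS2 HU HL => w hu hl.
apply: cvg_ratio_ln l0 hu hl => n n'.
exact: max_indegree_nondecreasing.
Qed.
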